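(* Let $K$ be a field of characteristic $0$, $m\ge2$, $c\ge1$, and let $L_{m,c}=L_m/(L_m''+L_m^{c+1})$ be the free metabelian nilpotent of class $c$ Lie algebra over $K$ with free generators $y_1,\dots,y_m$. Let $\omega$ be the ideal of polynomials without constant term in $K[t_1,\dots,t_m]$. (i) Let $u=\overline{u}+u_0\in L_{m,c}$, where \[ \overline{u}=\sum_{r=1}^mc_ry_r,\quad c_r\in K, \] is the linear component of $u$ and \[ u_0=\sum_{p>q}[y_p,y_q]\,h_{pq}(\mathrm{ad}\,y_q,\dots,\mathrm{ad}\,y_m),\qquad h_{pq}(t_q,\dots,t_m)\in K[t_1,\dots,t_m]/\omega^{c-1}. \] Then the Jacobian matrix of the inner automorphism $\exp(\mathrm{ad}\,u)$ is \[ J(\exp(\mathrm{ad}\,u))=J(\exp(\mathrm{ad}\,\overline{u}))+D_0T\equiv I_m+(\overline{D}+D_0)T\pmod{M_m(\omega^c)}, \] where \[ \overline{D}=\left(\frac{\partial[y_j,\overline{u}]}{\partial y_i}\right)_{i,j},\quad D_0\equiv\left(\frac{\partial[y_j,u_0]}{\partial y_i}\right)_{i,j}\pmod{M_m(\omega^c)},\quad T=\sum_{k=0}^{c-1}\frac{t^k}{(k+1)!},\quad t=\sum_{r=1}^mc_rt_r. \] (ii) The automorphisms $\theta$ of $L_{m,c}$ with the following Jacobian matrices (modulo $M_m(\omega^c)$) are coset representatives of the subgroup $\mathrm{Inn}(L_{m,c})$ of the group $\mathrm{IA}(L_{m,c})$: \[ J(\theta)=I_m+\left(\begin{array}{llll}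 s(t_2,\ldots,t_m)&f_{12}&\cdots&f_{1m}\\ t_1q_2(t_2,t_3,\ldots,t_m)+r_2(t_2,\ldots,t_m)&f_{22}&\cdots&f_{2m}\\ t_1q_3(t_3,\ldots,t_m)+r_3(t_2,\ldots,t_m)&f_{32}&\cdots&f_{3m}\\ \quad\vdots&\ \vdots&\ddots&\ \vdots\\ t_1q_m(t_m)+r_m(t_2,\ldots,t_m)&f_{m2}&\cdots&f_{mm} \end{array}\right), \] where $s,q_i,r_i,f_{ij}\in\omega/\omega^c$, i.e. they are polynomials of degree $\le c-1$ without constant terms, satisfying \[ s+\sum_{i=2}^mt_iq_i\equiv0,\quad\sum_{i=2}^mt_ir_i\equiv0,\quad\sum_{i=1}^mt_if_{ij}\equiv0\pmod{\omega^{c+1}},\quad j=2,\dots,m, \] such that $s=s(t_2,\dots,t_m)$ and $r_i=r_i(t_2,\dots,t_m)$, $i=2,\dots,m$, do not depend on $t_1$; $q_i=q_i(t_i,\dots,t_m)$, $i=2,\dots,m$, does not depend on $t_1,\dots,t_{i-1}$; and $f_{12}$ does not contain a summand $dt_2$ with $0\ne d\in K$ (i.e. the coefficient of $t_2$ in $f_{12}$ is zero).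
   Context: $L_m$ is the free Lie algebra over $K$ on $x_1,\dots,x_m$, $L_m^k$ is the $k$-th term of its lower central series, and $y_i$ is the image of $x_i$. Operators are written on the right: $u(\mathrm{ad}\,v)=[u,v]$. On the commutator ideal of $L_{m,c}$ the operators $\mathrm{ad}\,y_i$ commute, and every element of that ideal has the form displayed for $u_0$; an element of $K[t_1,\dots,t_m]/\omega^{c-1}$ may be identified with a polynomial of degree $\le c-2$ (with $\omega^0=K[t_1,\dots,t_m]$). $\mathrm{IA}(L_{m,c})$ is the group of automorphisms of $L_{m,c}$ inducing the identity modulo its commutator ideal. $\mathrm{Inn}(L_{m,c})$ is its normal subgroup of inner automorphisms $\exp(\mathrm{ad}\,u)=\sum_{k\ge0}(\mathrm{ad}\,u)^k/k!$, $u\in L_{m,c}$. A set $\Theta\subset\mathrm{IA}(L_{m,c})$ consists of coset representatives of $\mathrm{Inn}(L_{m,c})$ if $\mathrm{IA}(L_{m,c})$ is the disjoint union of the cosets $\mathrm{Inn}(L_{m,c})\theta$, $\theta\in\Theta$. Partial derivatives. Let $F_m=L_m/L_m''$ be the free metabelian Lie algebra, with free generators also denoted $y_1,\dots,y_m$. Let $A_m,B_m$ be abelian Lie algebras with bases $a_1,\dots,a_m$ and $b_1,\dots,b_m$. Let $C_m=\bigoplus_{i=1}^m a_iK[t_1,\dots,t_m]$ be the free right $K[t_1,\dots,t_m]$-module on $a_1,\dots,a_m$ with trivial Lie bracket. The abelian wreath product is the semidirect sum of $C_m$ and $B_m$ with $[C_m,C_m]=[B_m,B_m]=0$ and $[a_if,b_j]=a_i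 f t_j$. The homomorphism $\varepsilon$ of $F_m$ into it given by $\varepsilon(y_i)=a_i+b_i$ is injective. If $\varepsilon(f)=\sum_i\beta_ib_i+\sum_ia_if_i(t_1,\dots,t_m)$ with $\beta_i\in K$, then $\partial f/\partial y_i:=f_i$. For an element of $L_{m,c}=F_m/F_m^{c+1}$, the partial derivative $\partial/\partial y_i$ is the class in $K[t_1,\dots,t_m]/\omega^c$ of the partial derivative of any lift to $F_m$; such a class may be identified with a polynomial of degree $\le c-1$. For an endomorphism $\phi$ of $L_{m,c}$, its Jacobian matrix is $J(\phi)=\left(\partial\phi(y_j)/\partial y_i\right)$, with $i$ the row index and $j$ the column index, considered modulo the ideal $M_m(\omega^c)$ of $M_m(K[t_1,\dots,t_m])$. $I_m$ is the identity matrix. *)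

(* Defs.v *)
From HB Require Import structures.
From mathcomp Require Import all_boot all_order all_algebra.
From mathcomp Require Import boolp.
From mathcomp Require Import mpoly ring.

Set Implicit Arguments.
Unset Strict Implicit.
Unset Printing Implicit Defensive.

Import GRing.Theory.
Local Open Scope ring_scope.
Local Open Scope quotient_scope.

HB.mixin Record Lmodule_isLieAlgebra (K : fieldType) L of GRing.Lmodule K L := {
  lie : L -> L -> L;
  lie_linearl : forall w, linear (fun u => lie u w);
  lie_linearr : forall w, linear (lie w);
  lie_alt : forall u, lie u u = 0;
  lie_jacobi : forall u v w,
    lie (lie u v) w + lie (lie v w) u + lie (lie w u) v = 0
}.

#[short(type="lieAlgType")]
HB.structure Definition LieAlgebra (K : fieldType) :=
  { L of Lmodule_isLieAlgebra K L & GRing.Lmodule K L }.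

Section LieBasics.
Variables (K : fieldType) (L : lieAlgType K).
Implicit Types u v w : L.

Lemma lieDl u v w : lie (u + v) w = lie u w + lie v w.
Proof. by have := lie_linearl w 1 u v; rewrite !scale1r. Qed.

Lemma lieDr u v w : lie w (u + v) = lie w u + lie w v.
Proof. by have := lie_linearr w 1 u v; rewrite !scale1r. Qed.

Lemma lie0l w : lie 0 w = 0.
Proof. by apply: (addrI (lie 0 w)); rewrite -lieDl !addr0. Qed.

Lemma lie0r w : lie w 0 = 0.
Proof. by apply: (addrI (lie w 0)); rewrite -lieDr !addr0. Qed.

Lemma lieZl a u w : lie (a *: u) w = a *: lie u w.
Proof. by have := lie_linearl w a u 0; rewrite !addr0 lie0l addr0. Qed.

Lemma lieZr a u w : lie w (a *: u) = a *: lie w u.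
Proof. by have := lie_linearr w a u 0; rewrite !addr0 lie0r addr0. Qed.

Lemma lieNr u w : lie w (- u) = - lie w u.
Proof. by rewrite -scaleN1r lieZr scaleN1r. Qed.

Lemma lieNl u w : lie (- u) w = - lie u w.
Proof. by rewrite -scaleN1r lieZl scaleN1r. Qed.

Lemma lie_anti u v : lie u v = - lie v u.
Proof.
apply/eqP; rewrite -addr_eq0; apply/eqP.
by have := lie_alt (u + v); rewrite lieDl !lieDr !lie_alt add0r addr0.
Qed.

Lemma lie_der u v w : lie (lie u v) w = lie (lie u w) v + lie u (lie v w).
Proof.
have := lie_jacobi u v w.
rewrite (lie_anti (lie v w)) (lie_anti w u) lieNl => /eqP.
by rewrite -addrA -opprD subr_eq0 addrC => /eqP.
Qed.

End LieBasics.

Definition lie_hom (K : fieldType) (L M : lieAlgType K) (f : L -> M) : Prop :=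
  linear f /\ forall u v, f (lie u v) = lie (f u) (f v).

Record lie_ideal (K : fieldType) (L : lieAlgType K) := LieIdeal {
  ideal_mem :> L -> Prop;
  ideal0 : ideal_mem 0;
  idealP : forall a u v, ideal_mem u -> ideal_mem v -> ideal_mem (a *: u + v);
  ideal_lie : forall u v, ideal_mem u -> ideal_mem (lie u v)
}.

Inductive span (K : fieldType) (V : lmodType K) (S : V -> Prop) : V -> Prop :=
| span0 : span S 0
| spanP a u v : S u -> span S v -> span S (a *: u + v).

Section Ideals.
Variables (K : fieldType) (L : lieAlgType K).
Implicit Types (I J : lie_ideal L).

Lemma idealD I u v : I u -> I v -> I (u + v).
Proof. by move=> Iu Iv; rewrite -[u]scale1r; apply: idealP. Qed.

Lemma idealZ I a u : I u -> I (a *: u).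
Proof. by move=> Iu; rewrite -[_ *: _]addr0; apply: idealP => //; apply: ideal0. Qed.

Lemma idealN I u : I u -> I (- u).
Proof. by rewrite -scaleN1r; apply: idealZ. Qed.

Lemma ideal_lier I u v : I u -> I (lie v u).
Proof. by move=> Iu; rewrite lie_anti; apply/idealN/ideal_lie. Qed.

Lemma spanZD (V : lmodType K) (S : V -> Prop) a u v :
  span S u -> span S v -> span S (a *: u + v).
Proof.
move=> Su Sv; elim: Su => [|b s w Ss _ IH]; first by rewrite scaler0 add0r.
by rewrite scalerDr -addrA scalerA; apply: spanP.
Qed.

Definition full_ideal : lie_ideal L :=
  @LieIdeal K L (fun=> True) I (fun _ _ _ _ _ => I) (fun _ _ _ => I).

(* [I, J] is the linear span of the brackets, not merely their set. *)
Definition comm_mem I J : L -> Prop :=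
  span (fun w => exists u v, [/\ I u, J v & w = lie u v]).

Fact comm_ideal_lie I J u v : comm_mem I J u -> comm_mem I J (lie u v).
Proof.
elim=> [|a w z [p [q [Ip Jq ->]]] _ IH]; first by rewrite lie0l; apply: span0.
rewrite lieDl lieZl; apply: spanZD => //; rewrite lie_der.
rewrite -[X in X + _]scale1r; apply: spanP.
  by exists (lie p v), q; split=> //; apply: ideal_lie.
rewrite -[lie _ _]scale1r -[_ *: _]addr0; apply: spanP; last exact: span0.
by exists p, (lie q v); split=> //; apply: ideal_lie.
Qed.

Definition comm_ideal I J : lie_ideal L :=
  LieIdeal (@span0 K L _) (@spanZD L _) (@comm_ideal_lie I J).

Definition sum_mem I J : L -> Prop :=
  fun w => exists u v, [/\ I u, J v & w = u + v].

Fact sum_ideal0 I J : sum_mem I J 0.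
Proof. by exists 0, 0; split; rewrite ?addr0 //; apply: ideal0. Qed.

Fact sum_idealP I J a u v :
  sum_mem I J u -> sum_mem I J v -> sum_mem I J (a *: u + v).
Proof.
move=> [p [q [Ip Jq ->]]] [r [s [Ir Js ->]]].
exists (a *: p + r), (a *: q + s); split; try exact: idealP.
by rewrite scalerDr addrACA.
Qed.

Fact sum_ideal_lie I J u v : sum_mem I J u -> sum_mem I J (lie u v).
Proof.
move=> [p [q [Ip Jq ->]]]; exists (lie p v), (lie q v).
by split; rewrite ?lieDl //; apply: ideal_lie.
Qed.

Definition sum_ideal I J : lie_ideal L :=
  LieIdeal (sum_ideal0 I J) (@sum_idealP I J) (@sum_ideal_lie I J).

Definition derived : lie_ideal L := comm_ideal full_ideal full_ideal.
Definition derived2 : lie_ideal L := comm_ideal derived derived.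

(* Indexed from 1: lcs 1 = L and lcs k.+1 = [lcs k, L] for k > 0. *)
Definition lcs (k : nat) : lie_ideal L :=
  iter k.-1 (fun I => comm_ideal I full_ideal) full_ideal.

Lemma lcsS k : (0 < k)%N -> lcs k.+1 = comm_ideal (lcs k) full_ideal.
Proof. by case: k. Qed.

End Ideals.

Arguments full_ideal {K} L.
Arguments derived {K} L.
Arguments derived2 {K} L.
Arguments lcs {K} L k.

Section LieQuotient.
Variables (K : fieldType) (L : lieAlgType K) (I : lie_ideal L).

Definition quot_rel : rel L := fun u v => `[< I (u - v) >].

Fact quot_rel_refl : reflexive quot_rel.
Proof. by move=> u; apply/asboolP; rewrite subrr; apply: ideal0. Qed.

Fact quot_rel_sym : ssrbool.symmetric quot_rel.
Proof.
by move=> u v; apply/asboolP/asboolP => /idealN; rewrite opprB.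
Qed.

Fact quot_rel_trans : transitive quot_rel.
Proof.
move=> v u w /asboolP uv /asboolP vw; apply/asboolP.
by rewrite -(subrKA v); apply: idealD.
Qed.

Canonical quot_equiv := EquivRel quot_rel quot_rel_refl quot_rel_sym quot_rel_trans.

Definition lie_quot := {eq_quot quot_rel}.
HB.instance Definition _ := Choice.on lie_quot.
HB.instance Definition _ := EqQuotient.on lie_quot.

Lemma quotP (u v : L) : \pi_lie_quot u = \pi_lie_quot v <-> I (u - v).
Proof.
split; first by move/eqP; rewrite -[_ == _]/(\pi_{eq_quot quot_rel} u == _) eqmodE => /asboolP.
by move=> h; apply/eqP; rewrite -[_ == _]/(\pi_{eq_quot quot_rel} u == _) eqmodE; apply/asboolP.
Qed.

Lemma quot_repr (u : L) : I (repr (\pi_lie_quot u) - u).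
Proof. by apply/quotP; rewrite reprK. Qed.

Definition quot_zero : lie_quot := \pi_lie_quot 0.
Definition quot_opp (x : lie_quot) : lie_quot := \pi_lie_quot (- repr x).
Definition quot_add (x y : lie_quot) : lie_quot := \pi_lie_quot (repr x + repr y).
Definition quot_scale (a : K) (x : lie_quot) : lie_quot := \pi_lie_quot (a *: repr x).
Definition quot_lie (x y : lie_quot) : lie_quot := \pi_lie_quot (lie (repr x) (repr y)).

Fact quot_oppE u : quot_opp (\pi_lie_quot u) = \pi_lie_quot (- u).
Proof. by apply/quotP; rewrite -opprD; apply/idealN/quot_repr. Qed.

Fact quot_addE u v : quot_add (\pi_lie_quot u) (\pi_lie_quot v) = \pi_lie_quot (u + v).
Proof. by apply/quotP; rewrite opprD addrACA; apply: idealD; apply: quot_repr. Qed.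

Fact quot_scaleE a u : quot_scale a (\pi_lie_quot u) = \pi_lie_quot (a *: u).
Proof. by apply/quotP; rewrite -scalerBr; apply/idealZ/quot_repr. Qed.

Fact quot_lieE u v : quot_lie (\pi_lie_quot u) (\pi_lie_quot v) = \pi_lie_quot (lie u v).
Proof.
apply/quotP; rewrite -(subrKA (lie u (repr (\pi_lie_quot v)))).
rewrite -(lieNr v) -(lieNl u) -lieDl -lieDr; apply: idealD.
  exact/ideal_lie/quot_repr.
exact/ideal_lier/quot_repr.
Qed.

Fact quot_addA : associative quot_add.
Proof.
elim/quotW=> u; elim/quotW=> v; elim/quotW=> w.
by rewrite (quot_addE v w) (quot_addE u v) !quot_addE addrA.
Qed.

Fact quot_addC : commutative quot_add.
Proof. by elim/quotW=> u; elim/quotW=> v; rewrite !quot_addE addrC. Qed.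

Fact quot_add0 : left_id quot_zero quot_add.
Proof. by elim/quotW=> u; rewrite quot_addE add0r. Qed.

Fact quot_addN : left_inverse quot_zero quot_opp quot_add.
Proof. by elim/quotW=> u; rewrite quot_oppE quot_addE addNr. Qed.

HB.instance Definition _ :=
  GRing.isZmodule.Build lie_quot quot_addA quot_addC quot_add0 quot_addN.

Fact quot_scaleA a b x : quot_scale a (quot_scale b x) = quot_scale (a * b) x.
Proof. by elim/quotW: x => u; rewrite (quot_scaleE b u) !quot_scaleE scalerA. Qed.

Fact quot_scale1 : left_id 1 quot_scale.
Proof. by elim/quotW=> u; rewrite quot_scaleE scale1r. Qed.

Fact quot_scaleDr : right_distributive quot_scale +%R.
Proof.
move=> a; elim/quotW=> u; elim/quotW=> v.
by rewrite [_ + _]quot_addE (quot_scaleE a u) (quot_scaleE a v) quot_scaleE [RHS]quot_addE scalerDr.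
Qed.

Fact quot_scaleDl x : {morph quot_scale^~ x : a b / a + b}.
Proof.
elim/quotW: x => u a b.
by rewrite (quot_scaleE a u) (quot_scaleE b u) quot_scaleE [RHS]quot_addE scalerDl.
Qed.

HB.instance Definition _ := GRing.Zmodule_isLmodule.Build K lie_quot
  quot_scaleA quot_scale1 quot_scaleDr quot_scaleDl.

Lemma quot_pi_linear : linear (\pi_lie_quot : L -> lie_quot).
Proof.
by move=> a u v; rewrite [_ *: _ in RHS]quot_scaleE [RHS]quot_addE.
Qed.

Fact quot_lie_linearl w : linear (quot_lie^~ w).
Proof.
elim/quotW: w => w a; elim/quotW=> u; elim/quotW=> v.
by rewrite -quot_pi_linear (quot_lieE u w) (quot_lieE v w) quot_lieE lie_linearl quot_pi_linear.
Qed.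

Fact quot_lie_linearr w : linear (quot_lie w).
Proof.
elim/quotW: w => w a; elim/quotW=> u; elim/quotW=> v.
by rewrite -quot_pi_linear (quot_lieE w u) (quot_lieE w v) quot_lieE lie_linearr quot_pi_linear.
Qed.

Fact quot_lie_alt u : quot_lie u u = 0.
Proof. by elim/quotW: u => u; rewrite quot_lieE lie_alt. Qed.

Fact quot_lie_jacobi u v w :
  quot_lie (quot_lie u v) w + quot_lie (quot_lie v w) u
    + quot_lie (quot_lie w u) v = 0.
Proof.
elim/quotW: u => u; elim/quotW: v => v; elim/quotW: w => w.
rewrite (quot_lieE u v) (quot_lieE v w) (quot_lieE w u) !quot_lieE.
by rewrite [X in X + _]quot_addE [LHS]quot_addE lie_jacobi.
Qed.

HB.instance Definition _ := Lmodule_isLieAlgebra.Build K lie_quot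
  quot_lie_linearl quot_lie_linearr quot_lie_alt quot_lie_jacobi.

Definition quot_pi (u : L) : lie_quot := \pi_lie_quot u.

Lemma quot_pi_hom : lie_hom quot_pi.
Proof. by split; [exact: quot_pi_linear | move=> u v; rewrite [RHS]quot_lieE]. Qed.

End LieQuotient.

(* [free_lie] is the type of Lie expressions over X modulo [lteq], the least
   congruence containing the Lie algebra axioms. *)

Section FreeLie.
Variables (K : fieldType) (X : Type).

Inductive lterm : Type :=
| LVar of X
| LZero
| LAdd of lterm & lterm
| LScale of K & lterm
| LBr of lterm & lterm.

Inductive lteq : lterm -> lterm -> Prop :=
| lteq_refl s : lteq s s
| lteq_sym s t : lteq s t -> lteq t s
| lteq_trans s t r : lteq s t -> lteq t r -> lteq s r
| lteq_add s s' t t' : lteq s s' -> lteq t t' -> lteq (LAdd s t) (LAdd s' t')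
| lteq_scale a s s' : lteq s s' -> lteq (LScale a s) (LScale a s')
| lteq_br s s' t t' : lteq s s' -> lteq t t' -> lteq (LBr s t) (LBr s' t')
| lteq_addA s t r : lteq (LAdd s (LAdd t r)) (LAdd (LAdd s t) r)
| lteq_addC s t : lteq (LAdd s t) (LAdd t s)
| lteq_add0 s : lteq (LAdd LZero s) s
| lteq_addN s : lteq (LAdd (LScale (-1) s) s) LZero
| lteq_scaleA a b s : lteq (LScale a (LScale b s)) (LScale (a * b) s)
| lteq_scale1 s : lteq (LScale 1 s) s
| lteq_scaleDr a s t : lteq (LScale a (LAdd s t)) (LAdd (LScale a s) (LScale a t))
| lteq_scaleDl a b s : lteq (LScale (a + b) s) (LAdd (LScale a s) (LScale b s))
| lteq_brl a s t r :
    lteq (LBr (LAdd (LScale a s) t) r) (LAdd (LScale a (LBr s r)) (LBr t r))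
| lteq_brr a s t r :
    lteq (LBr r (LAdd (LScale a s) t)) (LAdd (LScale a (LBr r s)) (LBr r t))
| lteq_alt s : lteq (LBr s s) LZero
| lteq_jacobi s t r :
    lteq (LAdd (LAdd (LBr (LBr s t) r) (LBr (LBr t r) s)) (LBr (LBr r s) t)) LZero.

HB.instance Definition _ := gen_eqMixin lterm.
HB.instance Definition _ := gen_choiceMixin lterm.

Definition lteqb : rel lterm := fun s t => `[< lteq s t >].

Fact lteqb_refl : reflexive lteqb.
Proof. by move=> s; apply/asboolP/lteq_refl. Qed.

Fact lteqb_sym : ssrbool.symmetric lteqb.
Proof. by move=> s t; apply/asboolP/asboolP; apply: lteq_sym. Qed.

Fact lteqb_trans : transitive lteqb.
Proof.
by move=> t s r /asboolP st /asboolP tr; apply/asboolP/(lteq_trans st tr).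
Qed.

Canonical lteq_equiv := EquivRel lteqb lteqb_refl lteqb_sym lteqb_trans.

Definition free_lie := {eq_quot lteqb}.
HB.instance Definition _ := Choice.on free_lie.
HB.instance Definition _ := EqQuotient.on free_lie.

Lemma free_lieP s t : \pi_free_lie s = \pi_free_lie t <-> lteq s t.
Proof.
split; first by move/eqP; rewrite -[_ == _]/(\pi_{eq_quot lteqb} s == _) eqmodE => /asboolP.
by move=> h; apply/eqP; rewrite -[_ == _]/(\pi_{eq_quot lteqb} s == _) eqmodE; apply/asboolP.
Qed.

Fact free_lie_repr s : lteq (repr (\pi_free_lie s)) s.
Proof. by apply/free_lieP; rewrite reprK. Qed.

Definition fl_zero : free_lie := \pi_free_lie LZero.
Definition fl_add (x y : free_lie) : free_lie := \pi_free_lie (LAdd (repr x) (repr y)).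
Definition fl_scale (a : K) (x : free_lie) : free_lie := \pi_free_lie (LScale a (repr x)).
Definition fl_lie (x y : free_lie) : free_lie := \pi_free_lie (LBr (repr x) (repr y)).

Fact fl_addE s t : fl_add (\pi_free_lie s) (\pi_free_lie t) = \pi_free_lie (LAdd s t).
Proof. by apply/free_lieP/lteq_add; apply: free_lie_repr. Qed.

Fact fl_scaleE a s : fl_scale a (\pi_free_lie s) = \pi_free_lie (LScale a s).
Proof. by apply/free_lieP/lteq_scale/free_lie_repr. Qed.

Fact fl_lieE s t : fl_lie (\pi_free_lie s) (\pi_free_lie t) = \pi_free_lie (LBr s t).
Proof. by apply/free_lieP/lteq_br; apply: free_lie_repr. Qed.

Fact fl_addA : associative fl_add.
Proof.
elim/quotW=> s; elim/quotW=> t; elim/quotW=> r.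
by rewrite (fl_addE t r) (fl_addE s t) !fl_addE; apply/free_lieP/lteq_addA.
Qed.

Fact fl_addC : commutative fl_add.
Proof. by elim/quotW=> s; elim/quotW=> t; rewrite !fl_addE; apply/free_lieP/lteq_addC. Qed.

Fact fl_add0 : left_id fl_zero fl_add.
Proof. by elim/quotW=> s; rewrite fl_addE; apply/free_lieP/lteq_add0. Qed.

Fact fl_addN : left_inverse fl_zero (fl_scale (-1)) fl_add.
Proof.
by elim/quotW=> s; rewrite fl_scaleE fl_addE; apply/free_lieP/lteq_addN.
Qed.

HB.instance Definition _ :=
  GRing.isZmodule.Build free_lie fl_addA fl_addC fl_add0 fl_addN.

Fact fl_scaleA a b x : fl_scale a (fl_scale b x) = fl_scale (a * b) x.
Proof. by elim/quotW: x => s; rewrite (fl_scaleE b s) !fl_scaleE; apply/free_lieP/lteq_scaleA. Qed.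

Fact fl_scale1 : left_id 1 fl_scale.
Proof. by elim/quotW=> s; rewrite fl_scaleE; apply/free_lieP/lteq_scale1. Qed.

Fact fl_scaleDr : right_distributive fl_scale +%R.
Proof.
move=> a; elim/quotW=> s; elim/quotW=> t.
rewrite [_ + _]fl_addE (fl_scaleE a s) (fl_scaleE a t) fl_scaleE [RHS]fl_addE.
exact/free_lieP/lteq_scaleDr.
Qed.

Fact fl_scaleDl x : {morph fl_scale^~ x : a b / a + b}.
Proof.
elim/quotW: x => s a b.
rewrite (fl_scaleE a s) (fl_scaleE b s) fl_scaleE [RHS]fl_addE.
exact/free_lieP/lteq_scaleDl.
Qed.

HB.instance Definition _ := GRing.Zmodule_isLmodule.Build K free_lie
  fl_scaleA fl_scale1 fl_scaleDr fl_scaleDl.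

Fact fl_linE a s t :
  a *: (\pi_free_lie s : free_lie) + (\pi_free_lie t : free_lie)
    = \pi_free_lie (LAdd (LScale a s) t).
Proof. by rewrite [_ *: _]fl_scaleE [LHS]fl_addE. Qed.

Fact fl_lie_linearl w : linear (fl_lie^~ w).
Proof.
elim/quotW: w => r a; elim/quotW=> s; elim/quotW=> t.
by rewrite fl_linE (fl_lieE s r) (fl_lieE t r) fl_lieE fl_linE; apply/free_lieP/lteq_brl.
Qed.

Fact fl_lie_linearr w : linear (fl_lie w).
Proof.
elim/quotW: w => r a; elim/quotW=> s; elim/quotW=> t.
by rewrite fl_linE (fl_lieE r s) (fl_lieE r t) fl_lieE fl_linE; apply/free_lieP/lteq_brr.
Qed.

Fact fl_lie_alt u : fl_lie u u = 0.
Proof. by elim/quotW: u => s; rewrite fl_lieE; apply/free_lieP/lteq_alt. Qed.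

Fact fl_lie_jacobi u v w :
  fl_lie (fl_lie u v) w + fl_lie (fl_lie v w) u + fl_lie (fl_lie w u) v = 0.
Proof.
elim/quotW: u => s; elim/quotW: v => t; elim/quotW: w => r.
rewrite (fl_lieE s t) (fl_lieE t r) (fl_lieE r s) !fl_lieE.
rewrite [X in X + _]fl_addE [LHS]fl_addE.
exact/free_lieP/lteq_jacobi.
Qed.

HB.instance Definition _ := Lmodule_isLieAlgebra.Build K free_lie
  fl_lie_linearl fl_lie_linearr fl_lie_alt fl_lie_jacobi.

Definition free_gen (x : X) : free_lie := \pi_free_lie (LVar x).

Section Universal.
Variables (L : lieAlgType K) (f : X -> L).

Fixpoint lterm_eval (s : lterm) : L :=
  match s with
  | LVar x => f x
  | LZero => 0
  | LAdd s t => lterm_eval s + lterm_eval t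
  | LScale a s => a *: lterm_eval s
  | LBr s t => lie (lterm_eval s) (lterm_eval t)
  end.

Fact lterm_eval_eq s t : lteq s t -> lterm_eval s = lterm_eval t.
Proof.
elim=> {s t} //=; try congruence.
- by move=> s t r; rewrite addrA.
- by move=> s t; rewrite addrC.
- by move=> s; rewrite add0r.
- by move=> s; rewrite scaleN1r addNr.
- by move=> a b s; rewrite scalerA.
- by move=> s; rewrite scale1r.
- by move=> a s t; rewrite scalerDr.
- by move=> a b s; rewrite scalerDl.
- by move=> a s t r; rewrite lie_linearl.
- by move=> a s t r; rewrite lie_linearr.
- by move=> s; rewrite lie_alt.
- by move=> s t r; rewrite lie_jacobi.
Qed.

Definition free_lift (u : free_lie) : L := lterm_eval (repr u).

Fact free_liftE s : free_lift (\pi_free_lie s) = lterm_eval s.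
Proof. exact/lterm_eval_eq/free_lie_repr. Qed.

Lemma free_lift_hom : lie_hom free_lift.
Proof.
split=> [a|]; elim/quotW=> s; elim/quotW=> t; first by rewrite fl_linE !free_liftE.
by rewrite [lie _ _ in LHS]fl_lieE !free_liftE.
Qed.

Lemma free_lift_gen x : free_lift (free_gen x) = f x.
Proof. exact: free_liftE. Qed.

Lemma free_lift_unique (g : free_lie -> L) :
  lie_hom g -> (forall x, g (free_gen x) = f x) -> g =1 free_lift.
Proof.
move=> [glin glie] gx; elim/quotW=> s; rewrite free_liftE.
have gD u v : g (u + v) = g u + g v by rewrite -[u]scale1r glin !scale1r.
have g0 : g 0 = 0 by apply: (addrI (g 0)); rewrite -gD !addr0.
have gZ a u : g (a *: u) = a *: g u by rewrite -[_ *: u]addr0 glin g0 addr0.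
elim: s => [x||s IHs t IHt|a s IHs|s IHs t IHt] /=.
- exact: gx.
- exact: g0.
- by rewrite -IHs -IHt -gD [_ + _]fl_addE.
- by rewrite -IHs -gZ [_ *: _]fl_scaleE.
- by rewrite -IHs -IHt -glie [lie _ _]fl_lieE.
Qed.

End Universal.
End FreeLie.

Section Omega.
Variables (K : fieldType) (m : nat).
Implicit Types f g : {mpoly K[m]}.

Definition omega f : Prop := f@_0%MM = 0.

Fixpoint omegaX (k : nat) f : Prop :=
  if k is k'.+1 then
    exists2 s : seq ({mpoly K[m]} * {mpoly K[m]}),
      forall p, p \in s -> omega p.1 /\ omegaX k' p.2
      & f = \sum_(p <- s) p.1 * p.2
  else True.

Definition eqmodX k f g : Prop := omegaX k (f - g).

Definition mx_eqmodX k (A B : 'M[{mpoly K[m]}]_m) : Prop :=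
  forall i j, eqmodX k (A i j) (B i j).

Definition free_of f (i : 'I_m) : Prop :=
  forall e : 'X_{1..m}, e \in msupp f -> e i = 0%N.

Lemma omegaX0 k : omegaX k 0.
Proof. by case: k => // k; exists [::]; rewrite ?big_nil. Qed.

Lemma omegaXD k f g : omegaX k f -> omegaX k g -> omegaX k (f + g).
Proof.
case: k => // k [s hs ->] [r hr ->]; exists (s ++ r); last by rewrite big_cat.
by move=> p; rewrite mem_cat => /orP[/hs|/hr].
Qed.

Lemma omegaXM k f g : omegaX k f -> omegaX k (f * g).
Proof.
elim: k f => // k IH f [s hs ->].
exists [seq (p.1, p.2 * g) | p <- s]; last first.
  by rewrite big_map mulr_suml; apply: eq_bigr => p _; rewrite mulrA.
by move=> _ /mapP[p /hs[o oX] ->]; split=> //=; apply: IH.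
Qed.

Lemma omegaXS k f g : omegaX k f -> omega g -> omegaX k.+1 (f * g).
Proof.
move=> oX o; exists [:: (g, f)]; last by rewrite big_seq1 mulrC.
by move=> p; rewrite inE => /eqP ->.
Qed.

Lemma omegaXZ k a f : omegaX k f -> omegaX k (a *: f).
Proof. by rewrite -mul_mpolyC mulrC; apply: omegaXM. Qed.

Lemma omega_X i : omega 'X_i.
Proof. by rewrite /omega mcoeffX; case: eqP => // /mnmP /(_ i); rewrite mnm1E eqxx mnm0E. Qed.

Lemma omega_lin (b : 'I_m -> K) : omega (\sum_j b j *: 'X_j).
Proof.
rewrite /omega raddf_sum big1 //= => j _.
by rewrite mcoeffZ (omega_X j) mulr0.
Qed.

End Omega.

Arguments omegaX {K m} k f : simpl never.

Section Wreath.
Variables (K : fieldType) (m : nat).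

(* The pair (f, beta) stands for \sum_i beta_i b_i + \sum_i a_i f_i(t). *)
Definition wreath : Type :=
  ({ffun 'I_m -> {mpoly K[m]}} * {ffun 'I_m -> K^o})%type.

HB.instance Definition _ := GRing.Lmodule.on wreath.

Definition wr_t (b : {ffun 'I_m -> K^o}) : {mpoly K[m]} := \sum_j b j *: 'X_j.

(* Encodes [a_i f, b_j] = a_i (f t_j), extended bilinearly. *)
Definition wr_lie (x y : wreath) : wreath :=
  ([ffun i => x.1 i * wr_t y.2 - y.1 i * wr_t x.2], 0).

Fact wr_t_lin : linear wr_t.
Proof.
move=> a b d; rewrite /wr_t scaler_sumr -big_split /=.
by apply: eq_bigr => j _; rewrite !ffunE scalerDl scalerA.
Qed.

Fact wr_t0 : wr_t 0 = 0.
Proof. by rewrite /wr_t big1 // => j _; rewrite ffunE scale0r. Qed.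

Fact wr_linearl w : linear (wr_lie^~ w).
Proof.
move=> a x y; rewrite /wr_lie; congr pair => /=; last by rewrite scaler0 addr0.
apply/ffunP => i; rewrite !ffunE /= wr_t_lin.
rewrite mulrDl mulrDr opprD addrACA scalerBr -scalerAl -scalerAr.
by [].
Qed.

Fact wr_linearr w : linear (wr_lie w).
Proof.
move=> a x y; rewrite /wr_lie; congr pair => /=; last by rewrite scaler0 addr0.
apply/ffunP => i; rewrite !ffunE /= wr_t_lin.
rewrite mulrDl mulrDr opprD addrACA scalerBr -scalerAl -scalerAr.
by [].
Qed.

Fact wr_alt x : wr_lie x x = 0.
Proof. by congr pair; apply/ffunP => i; rewrite !ffunE subrr. Qed.

Fact wr_jacobi x y z :
  wr_lie (wr_lie x y) z + wr_lie (wr_lie y z) x + wr_lie (wr_lie z x) y = 0.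
Proof.
congr pair => /=; last by rewrite !addr0.
apply/ffunP => i; rewrite !ffunE /= wr_t0 !mulr0 !subr0 !mulrBl.
ring.
Qed.


HB.instance Definition _ := Lmodule_isLieAlgebra.Build K wreath
  wr_linearl wr_linearr wr_alt wr_jacobi.

Definition wr_gen (i : 'I_m) : wreath :=
  ([ffun k => (k == i)%:R], [ffun k => (k == i)%:R]).

End Wreath.

Section PartialDerivatives.
Variables (K : fieldType) (m : nat).

Definition Lm : lieAlgType K := free_lie K 'I_m.
Definition Fm : lieAlgType K := lie_quot (derived2 Lm).

Definition eps_free : Lm -> wreath K m := free_lift (@wr_gen K m).

(* This is the homomorphism F_m -> wreath induced by [eps_free]; see [epsE]. *)
Definition eps (v : Fm) : wreath K m := eps_free (repr v).

Definition fox (i : 'I_m) (v : Fm) : {mpoly K[m]} := (eps v).1 i.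

Lemma eps_free_derived u : derived Lm u -> (eps_free u).2 = 0.
Proof.
have [lin hom] := free_lift_hom (@wr_gen K m).
elim=> [|a w z [p [q [_ _ ->]]] _ IH].
  by rewrite /eps_free -[0](addNr 0) -scaleN1r lin scaleN1r addNr.
by rewrite /eps_free lin hom /= scaler0 add0r.
Qed.

Lemma eps_free_derived2 u : derived2 Lm u -> eps_free u = 0.
Proof.
have [lin hom] := free_lift_hom (@wr_gen K m).
elim=> [|a w z [p [q [dp dq ->]]] _ IH].
  by rewrite /eps_free -[0](addNr 0) -scaleN1r lin scaleN1r addNr.
rewrite /eps_free lin -/(eps_free z) IH addr0 hom.
rewrite -[RHS](scaler0 _ a); congr (_ *: _); congr pair; apply/ffunP => i.
by rewrite !ffunE /= !eps_free_derived // wr_t0 !mulr0 subr0.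
Qed.

Lemma eps_freeB u v : eps_free (u - v) = eps_free u - eps_free v.
Proof.
have [lin _] := free_lift_hom (@wr_gen K m).
by rewrite addrC -scaleN1r /eps_free lin scaleN1r addrC.
Qed.

Lemma epsE u : eps (quot_pi (derived2 Lm) u) = eps_free u.
Proof.
apply/eqP; rewrite -subr_eq0 -eps_freeB; apply/eqP/eps_free_derived2.
exact: quot_repr.
Qed.

Lemma eps_hom : lie_hom eps.
Proof.
have [lin hom] := free_lift_hom (@wr_gen K m).
have [plin phom] := quot_pi_hom (derived2 Lm).
have E (w : Fm) : w = quot_pi (derived2 Lm) (repr w) by rewrite /quot_pi reprK.
split=> [a|] u v; rewrite (E u) (E v).
  by rewrite -plin !epsE /eps_free lin.
by rewrite -phom !epsE /eps_free hom.
Qed.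

Lemma eps_gen i : eps (quot_pi (derived2 Lm) (free_gen K i)) = wr_gen K i.
Proof. by rewrite epsE /eps_free free_lift_gen. Qed.

End PartialDerivatives.

Section FreeMetabelianNilpotent.
Variables (K : fieldType) (m c : nat).

Definition Lmc_ideal : lie_ideal (Lm K m) :=
  sum_ideal (derived2 (Lm K m)) (lcs (Lm K m) c.+1).

Definition Lmc : lieAlgType K := lie_quot Lmc_ideal.

Definition gen (i : 'I_m) : Lmc := quot_pi Lmc_ideal (free_gen K i).

(* The derivative of one chosen lift to F_m.  Only its class modulo omega^c
   is meaningful, and that class does not depend on the lift: see [pdE]. *)
Definition pd (i : 'I_m) (u : Lmc) : {mpoly K[m]} :=
  fox i (quot_pi (derived2 (Lm K m)) (repr u)).

Lemma eps_free_lcs k u i : lcs (Lm K m) k.+1 u -> omegaX k ((eps_free u).1 i).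
Proof.
have [lin hom] := free_lift_hom (@wr_gen K m).
elim: k u => [//|k IH] u; rewrite lcsS //.
elim=> [|a w z [p [q [lp _ ->]]] _ oz].
  rewrite /eps_free -[0](addNr 0) -scaleN1r lin scaleN1r addNr ffunE.
  exact: omegaX0.
rewrite /eps_free lin hom /= !ffunE; apply: omegaXD => //; apply: omegaXZ.
case: k {oz} IH lp => [_ _|k IH lp].
  apply: omegaXD; first by apply: (@omegaXS _ _ 0) => //; apply: omega_lin.
  rewrite -mulrN; apply: (@omegaXS _ _ 0) => //.
  by rewrite /wr_t -sumrN /omega raddf_sum big1 //= => j _;
    rewrite mcoeffN mcoeffZ (omega_X K j) mulr0 oppr0.
have d : derived (Lm K m) p.
  move: lp; rewrite lcsS //; elim=> [|b x y [r [t [_ _ ->]]] _]; first exact: span0.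
  by apply: spanP; exists r, t.
rewrite (eps_free_derived d) wr_t0 mulr0 subr0.
by apply: omegaXS; [exact: IH | exact: omega_lin].
Qed.

Lemma pdE i (x : Lm K m) (u : Lmc) :
  quot_pi Lmc_ideal x = u ->
  eqmodX c (pd i u) (fox i (quot_pi (derived2 (Lm K m)) x)).
Proof.
move=> <-; rewrite /eqmodX /pd /fox !epsE.
have [p [q [dp lq E]]] := @quot_repr _ _ Lmc_ideal x.
have <- : (eps_free (repr (quot_pi Lmc_ideal x) - x)).1 i
  = (eps_free (repr (quot_pi Lmc_ideal x))).1 i - (eps_free x).1 i.
  by rewrite eps_freeB !ffunE.
have [lin _] := free_lift_hom (@wr_gen K m).
rewrite E -[p]scale1r /eps_free lin scale1r -/(eps_free p) -/(eps_free q).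
by rewrite eps_free_derived2 // add0r; apply: eps_free_lcs.
Qed.

Definition Jac (phi : Lmc -> Lmc) : 'M[{mpoly K[m]}]_m :=
  \matrix_(i, j) pd i (phi (gen j)).

Definition ad (v u : Lmc) : Lmc := lie u v.

(* The exponential series; its terms with k >= c vanish by [ad_nilp]. *)
Definition exp_ad (u : Lmc) : Lmc -> Lmc :=
  fun v => \sum_(k < c) (k`!%:R : K)^-1 *: iter k (ad u) v.

Lemma lcs_lift k (x : Lmc) : lcs Lmc k.+1 x ->
  exists2 y, lcs (Lm K m) k.+1 y & x = quot_pi Lmc_ideal y.
Proof.
have [lin hom] := quot_pi_hom Lmc_ideal.
have pi0 : quot_pi Lmc_ideal 0 = 0.
  by rewrite -[0 in LHS](addNr 0) -scaleN1r lin scaleN1r addNr.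
elim: k x => [|k IH] x.
  by move=> _; exists (repr x) => //; rewrite /quot_pi reprK.
rewrite {1}lcsS //.
elim=> [|a w z [p [q [lp _ ->]]] _ [y ly ->]].
  by exists 0; [apply: ideal0 | rewrite pi0].
have [p' lp' ->] := IH _ lp.
exists (a *: lie p' (repr q) + y); last by rewrite lin hom /quot_pi reprK.
apply: idealP ly; rewrite lcsS // -[lie _ _]scale1r -[_ *: _]addr0.
by apply: spanP; [exists p', (repr q) | apply: span0].
Qed.

Lemma lcs_Lmc_eq0 (x : Lmc) : lcs Lmc c.+1 x -> x = 0.
Proof.
move=> /lcs_lift[y ly ->]; apply/quotP; rewrite subr0.
by exists 0, y; split=> //; [apply: span0 | rewrite add0r].
Qed.

Lemma ad_nilp u k v : (c <= k)%N -> iter k (ad u) v = 0.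
Proof.
have iterP n : lcs Lmc n.+1 (iter n (ad u) v).
  elim: n => [//|n IH]; rewrite lcsS //= -[ad _ _]scale1r -[_ *: _]addr0.
  by apply: spanP; [exists (iter n (ad u) v), u | apply: span0].
move/subnKC <-; rewrite addnC iterD (lcs_Lmc_eq0 (iterP c)).
by elim: (k - c)%N => //= n ->; rewrite /ad lie0l.
Qed.

(* h(ad y_1, ..., ad y_m) applied to w; meant for w in the commutator ideal,
   where the operators ad y_i commute, so that their order is immaterial. *)
Definition ad_monom (e : 'X_{1..m}) (w : Lmc) : Lmc :=
  foldl (fun w i => iter (e i) (ad (gen i)) w) w (enum 'I_m).

Definition ad_poly (h : {mpoly K[m]}) (w : Lmc) : Lmc :=
  \sum_(e <- msupp h) h@_e *: ad_monom e w.

Definition automorphism (phi : Lmc -> Lmc) : Prop :=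
  lie_hom phi /\ bijective phi.

Definition IA (phi : Lmc -> Lmc) : Prop :=
  automorphism phi /\ forall u, derived Lmc (phi u - u).

Definition Inn (phi : Lmc -> Lmc) : Prop := exists u, phi = exp_ad u.

Definition Inn_coset (theta phi : Lmc -> Lmc) : Prop :=
  exists2 psi, Inn psi & phi = psi \o theta.

Definition Inn_coset_representatives (Theta : (Lmc -> Lmc) -> Prop) : Prop :=
  [/\ forall theta, Theta theta -> IA theta,
      forall phi, IA phi <-> exists2 theta, Theta theta & Inn_coset theta phi
    & forall theta1 theta2 phi, Theta theta1 -> Theta theta2 ->
        Inn_coset theta1 phi -> Inn_coset theta2 phi -> theta1 = theta2].

End FreeMetabelianNilpotent.

Section Representatives.
Variables (K : fieldType) (m c : nat) (m_ge2 : (2 <= m)%N).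
Implicit Types (s : {mpoly K[m]}) (q r : 'I_m -> {mpoly K[m]}).
Implicit Types (f : 'I_m -> 'I_m -> {mpoly K[m]}) (i j k : 'I_m).

(* Indices are 0-based: the variable t_k is 'X_i with i = k - 1. *)
Definition ix1 : 'I_m := Ordinal (ltnW m_ge2).
Definition ix2 : 'I_m := Ordinal m_ge2.

Definition in_omega_mod (g : {mpoly K[m]}) : Prop :=
  omega g /\ (msize g <= c)%N.

(* q ix1, r ix1 and f i ix1 are never used. *)
Definition rep_matrix s q r f : 'M[{mpoly K[m]}]_m :=
  \matrix_(i, j)
    if j == ix1 then if i == ix1 then s else 'X_ix1 * q i + r i
    else f i j.

Record rep_entries s q r f : Prop := RepEntries {
  rep_s : in_omega_mod s;
  rep_q : forall i, i != ix1 -> in_omega_mod (q i);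
  rep_r : forall i, i != ix1 -> in_omega_mod (r i);
  rep_f : forall i j, j != ix1 -> in_omega_mod (f i j);
  rep_sum_q : eqmodX c.+1 (s + \sum_(i | i != ix1) 'X_i * q i) 0;
  rep_sum_r : eqmodX c.+1 (\sum_(i | i != ix1) 'X_i * r i) 0;
  rep_sum_f : forall j, j != ix1 -> eqmodX c.+1 (\sum_i 'X_i * f i j) 0;
  rep_s_vars : free_of s ix1;
  rep_r_vars : forall i, i != ix1 -> free_of (r i) ix1;
  rep_q_vars : forall i k, i != ix1 -> (k < i)%N -> free_of (q i) k;
  rep_f12 : (f ix1 ix2)@_(U_(ix2))%MM = 0
}.

Definition Theta (theta : Lmc K m c -> Lmc K m c) : Prop :=
  automorphism theta /\
  exists s q r f, rep_entries s q r f /\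
    mx_eqmodX c (Jac theta) (1%:M + rep_matrix s q r f).

End Representatives.

(* Main.v *)
Require Import Defs.
From HB Require Import structures.
From mathcomp Require Import all_boot all_order all_algebra.
From mathcomp Require Import boolp ssrcomplements mpoly ring.

(* The Jacobian of an element of the commutator ideal is a syzygy of (t_1, ..., t_m),
   and conversely: Euler's homotopy for the Koszul complex, which needs characteristic
   0, sends a vector A to sum_(i,j) [y_i, y_j] (d_j E A_i)(ad y), where E divides each
   homogeneous component of degree d by d + 1.  It vanishes on vectors over omega^c, and
   it is a left inverse of the Jacobian on the commutator ideal and a right inverse on
   syzygies.
   Hence automorphisms in IA are the same thing as matrices of syzygies modulo omega^c.

   Write u = sum a_r y_r + u_0, t = sum a_r t_r and let U be the Jacobian of u_0.  As the
   algebra is metabelian, ad u acts on the commutator ideal as multiplication by t, so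
   composing with exp (ad u) turns a column W_j into
   T (t e_j - t_j (a + U)) + exp t W_j.  The linear terms of the first column and of the
   entry (1, 2) determine a; the multiples of t_1 in the first column determine U. *)

Set Implicit Arguments.
Unset Strict Implicit.
Unset Printing Implicit Defensive.
Import GRing.Theory.
Local Open Scope ring_scope.

Local Notation span := Defs.span.

(** * Polynomials modulo powers of omega *)

Section LinearExtension.
Variables (K : fieldType) (m : nat) (V : lmodType K) (g : 'X_{1..m} -> V).
Implicit Types f : {mpoly K[m]}.

(** The linear map with value [g e] on the monomial ['X_[e]]. Diagonal operators, division by a
    variable and the Euler lift are all instances. *)
Definition mext f : V := \sum_(e <- msupp f) f@_e *: g e.

(** Supports vary with the polynomial, so linearity is checked on sums over one box of exponents
    that contains all the supports involved. *)
Lemma mextwE n f : (msize f <= n)%N ->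
  mext f = \sum_(e : 'X_{1..m < n}) f@_e *: g e.
Proof.
move=> le_fn; pose I : subFinType _ := 'X_{1..m < n}.
rewrite /mext (big_mksub I) ?msupp_uniq //=; last first.
  by move=> e /msize_mdeg_lt /leq_trans; apply.
by rewrite big_rmcond //= => e /memN_msupp_eq0 ->; rewrite scale0r.
Qed.

Fact mext_linear : linear mext.
Proof.
move=> a f1 f2; pose n := maxn (msize f1) (maxn (msize f2) (msize (a *: f1 + f2))).
have [h1 h2 h3] : [/\ (msize f1 <= n)%N, (msize f2 <= n)%N & (msize (a *: f1 + f2)%R <= n)%N].
  by rewrite !leq_max !leqnn ?orbT.
rewrite !(mextwE (n := n)) // scaler_sumr -big_split /=; apply: eq_bigr => e _.
by rewrite mcoeffD mcoeffZ scalerDl scalerA.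
Qed.

HB.instance Definition _ := GRing.isLinear.Build K {mpoly K[m]} V _ mext mext_linear.

Lemma mextX e : mext 'X_[e] = g e.
Proof. by rewrite /mext msuppX big_seq1 mcoeffX eqxx scale1r. Qed.

End LinearExtension.

(** * Operators acting monomial by monomial *)

Section DiagonalOperators.
Variables (K : fieldType) (m : nat).
Implicit Types (f : {mpoly K[m]}) (g : 'X_{1..m} -> K) (d e : 'X_{1..m}).

Definition mdiag g f : {mpoly K[m]} := mext (fun e => g e *: 'X_[e]) f.

HB.instance Definition _ g := GRing.isLinear.Build K {mpoly K[m]} {mpoly K[m]} _ (mdiag g) (mext_linear _).

Lemma mcoeff_mdiag g f e : (mdiag g f)@_e = g e * f@_e.
Proof.
rewrite {2}[f]mpolyE /mdiag /mext !raddf_sum mulr_sumr /=.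
apply: eq_bigr => d _; rewrite !mcoeffZ mcoeffX.
by case: eqP => [->|_]; rewrite ?mulr1 ?mulr0 // mulrC.
Qed.

Lemma mnm1_le k d : (0 < d k)%N -> (U_(k) <= d)%MM.
Proof. by move=> dk; apply/mnm_lepP => i; rewrite mnm1E; case: eqP => [<-|]. Qed.

Lemma mcoeff_XM k f d :
  ('X_k * f)@_d = if (0 < d k)%N then f@_(d - U_(k))%MM else 0.
Proof.
case: ifP => [dk|/negbT]; last rewrite -eqn0Ngt => /eqP dk.
  by rewrite mulrC -{1}(submK (mnm1_le dk)) addmC mcoeffMX.
apply/eqP; rewrite mcoeff_eq0; apply/negP => /msuppM_le /allpairsP[[a b] /=].
rewrite msuppX inE => -[/eqP-> _ E].
by move: dk; rewrite E mnmDE mnm1E eqxx.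
Qed.

(** The test [0 < e k] discards the monomials not divisible by ['X_k], which the truncated
    subtraction [e - U_(k)] would leave unchanged. *)
Definition mdivX k f : {mpoly K[m]} :=
  mext (fun e => if (0 < e k)%N then 'X_[e - U_(k)] else 0) f.

HB.instance Definition _ k := GRing.isLinear.Build K {mpoly K[m]} {mpoly K[m]} _ (mdivX k) (mext_linear _).

Lemma mcoeff_mdivX k f d : (mdivX k f)@_d = f@_(d + U_(k))%MM.
Proof.
rewrite {2}[f]mpolyE /mdivX /mext !raddf_sum /=.
apply: eq_bigr => e _; rewrite !mcoeffZ mcoeffX; congr (_ * _).
case: ifP => [ek|ek]; rewrite ?mcoeff0 ?mcoeffX.
  congr ((_ : bool)%:R); rewrite -(inj_eq (@addIm _ U_(k)%MM)) submK //.
  exact: mnm1_le.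
case: eqP => // E; by move: ek; rewrite E mnmDE mnm1E eqxx addn1.
Qed.

Lemma mulX_mdivX k f : 'X_k * mdivX k f = mdiag (fun e => (0 < e k)%:R) f.
Proof.
apply/mpolyP => d; rewrite mcoeff_XM mcoeff_mdiag.
case: ifP => dk; rewrite ?mul0r // mul1r mcoeff_mdivX submK //.
exact: mnm1_le.
Qed.

End DiagonalOperators.

(** * Powers of omega and congruences modulo them *)

Section OmegaPowers.
Variables (K : fieldType) (m : nat).
Implicit Types (f g : {mpoly K[m]}) (d e : 'X_{1..m}).

Lemma omegaX_mul j k f g : omegaX j f -> omegaX k g -> omegaX (j + k) (f * g).
Proof.
elim: j f => [|j IH] f; first by move=> _ og; rewrite mulrC; apply: omegaXM.
move=> [s hs ->] og; exists [seq (p.1, p.2 * g) | p <- s].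
  by move=> _ /mapP[p /hs[o oX] ->]; split=> //=; apply: IH.
by rewrite big_map mulr_suml; apply: eq_bigr => p _; rewrite mulrA.
Qed.

Lemma omegaX_sum k (I : Type) (r : seq I) (P : pred I) (F : I -> {mpoly K[m]}) :
  (forall i, P i -> omegaX k (F i)) -> omegaX k (\sum_(i <- r | P i) F i).
Proof.
move=> h; elim/big_rec: _ => [|i f Pi of_]; first exact: omegaX0.
by apply: omegaXD => //; apply: h.
Qed.

Lemma omegaX_mull k f g : omegaX k f -> omegaX k (g * f).
Proof. by move=> ?; rewrite mulrC; apply: omegaXM. Qed.

Lemma omegaXN k f : omegaX k f -> omegaX k (- f).
Proof. by rewrite -scaleN1r; apply: omegaXZ. Qed.

Lemma omegaXB k f g : omegaX k f -> omegaX k g -> omegaX k (f - g).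
Proof. by move=> ? ?; apply: omegaXD => //; apply: omegaXN. Qed.

Lemma omega_omegaX1 f : omega f -> omegaX 1 f.
Proof. by move=> o; rewrite -[f]mul1r; apply: (@omegaXS _ _ 0). Qed.

Lemma mcoeff_mul_low j k f g :
  (forall e, (mdeg e < j)%N -> f@_e = 0) -> (forall e, (mdeg e < k)%N -> g@_e = 0) ->
  forall e, (mdeg e < j + k)%N -> (f * g)@_e = 0.
Proof.
move=> hf hg e lt_e; apply/eqP; rewrite mcoeff_eq0.
apply/negP => /msuppM_le /allpairsP[[a b] /= []].
rewrite !mcoeff_msupp => fa gb E; move: lt_e; rewrite E mdegD ltnNge.
suff -> : (j + k <= mdeg a + mdeg b)%N by [].
apply: leq_add; rewrite leqNgt.
- by apply: contra fa => /hf ->.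
- by apply: contra gb => /hg ->.
Qed.

(** A product with k factors in omega has no monomial of degree below k; conversely, a monomial of
    degree at least k splits off a variable k times. Membership thus becomes a condition on
    coefficients. *)
Lemma omegaXP k f : omegaX k f <-> forall e, (mdeg e < k)%N -> f@_e = 0.
Proof.
split.
  elim: k f => // k IH f [s hs ->] e lt_e; rewrite raddf_sum big_seq big1 //= => p ps.
  have [o oX] := hs p ps; apply: (@mcoeff_mul_low 1 k) lt_e; last exact: IH.
  by move=> d; rewrite ltnS leqn0 mdeg_eq0 => /eqP ->.
move=> h; rewrite [f]mpolyE big_seq; apply: omegaX_sum => e; rewrite mcoeff_msupp => fe.
have {}h : (k <= mdeg e)%N by rewrite leqNgt; apply: contra fe => /h ->.
apply: omegaXZ; elim: k e h {fe} => // k IH e.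
rewrite mdegE; have [[i ei]|/forallNP h] := pselect (exists i, (0 < e i)%N); last first.
  by rewrite big1 // => i _; apply/eqP; rewrite eqn0Ngt; apply/negP/h.
have le_e := mnm1_le ei.
rewrite -mdegE -(submK le_e) mdegD mdeg1 addn1 ltnS => /IH oX.
by rewrite mpolyXD; apply: omegaXS => //; apply: omega_X.
Qed.

Lemma omegaXW j k f : (j <= k)%N -> omegaX k f -> omegaX j f.
Proof.
move=> le_jk /omegaXP h; apply/omegaXP => e lt_e.
by apply: h; apply: leq_trans lt_e le_jk.
Qed.

Lemma omegaX_small k f : (msize f <= k)%N -> omegaX k f -> f = 0.
Proof.
move=> le_f /omegaXP h; apply/mpolyP => e; rewrite mcoeff0.
have [/h//|ge_e] := ltnP (mdeg e) k.
by apply/eqP; rewrite mcoeff_eq0; apply/msize_mdeg_ge/(leq_trans le_f).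
Qed.

Lemma omegaX_expr k f : omega f -> omegaX k (f ^+ k).
Proof.
move=> o; elim: k => // k IH; rewrite exprS mulrC.
exact: omegaXS.
Qed.

Lemma eq_eqmodX k f g : f = g -> eqmodX k f g.
Proof. by move=> ->; rewrite /eqmodX subrr; apply: omegaX0. Qed.

Lemma eqmodX_trans k f g h : eqmodX k f g -> eqmodX k g h -> eqmodX k f h.
Proof. by move=> fg gh; rewrite /eqmodX -(subrKA g); apply: omegaXD. Qed.

Lemma eqmodX_sym k f g : eqmodX k f g -> eqmodX k g f.
Proof. by move=> /omegaXN; rewrite opprB. Qed.

Lemma eqmodX_add k f f' g g' :
  eqmodX k f f' -> eqmodX k g g' -> eqmodX k (f + g) (f' + g').
Proof. by move=> hf hg; rewrite /eqmodX opprD addrACA; apply: omegaXD. Qed.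

Lemma eqmodX_sub k f f' g g' :
  eqmodX k f f' -> eqmodX k g g' -> eqmodX k (f - g) (f' - g').
Proof. by move=> hf /eqmodX_sym hg; apply: eqmodX_add => //; rewrite /eqmodX opprK addrC. Qed.

Lemma eqmodX_mull k f g h : eqmodX k f g -> eqmodX k (h * f) (h * g).
Proof. by move=> fg; rewrite /eqmodX -mulrBr; apply: omegaX_mull. Qed.

Lemma eqmodX_mulr k f g h : eqmodX k f g -> eqmodX k (f * h) (g * h).
Proof. by move=> fg; rewrite ![_ * h]mulrC; apply: eqmodX_mull. Qed.

(** The inverse is a partial sum of the geometric series in [1 - f]. The error is [(1 - f) ^+ k] up
    to sign, and [1 - f] has no constant term. *)
Lemma eqmodX_inv k f : f@_0%MM = 1 -> exists g, eqmodX k (f * g) 1.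
Proof.
move=> f0; exists (\sum_(i < k) (1 - f) ^+ i); rewrite /eqmodX.
have -> : f * \sum_(i < k) (1 - f) ^+ i - 1 = - (1 - f) ^+ k.
  have := subrX1 (1 - f) k; rewrite addrAC subrr add0r mulNr => E.
  by rewrite -[f * _]opprK -E opprB addrC addrA addNr add0r.
by apply/omegaXN/omegaX_expr; rewrite /omega mcoeffB mcoeff1 eqxx f0 subrr.
Qed.

(** Both [f - 1] and [g] lie in omega, so their product lies in omega^2 and has no linear terms. *)
Lemma mul_unit_linear_coeff f g i :
  f@_0%MM = 1 -> omega g -> (f * g)@_U_(i)%MM = g@_U_(i)%MM.
Proof.
move=> f0 og; have -> : f * g = (f - 1) * g + g by ring.
rewrite mcoeffD; have /omegaXP-> : omegaX 2 ((f - 1) * g) by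
  apply: (@omegaX_mul 1 1); apply: omega_omegaX1; rewrite // /omega mcoeffB mcoeff1 eqxx f0 subrr.
  by rewrite add0r.
by rewrite mdeg1.
Qed.

Lemma omegaX_XM k i f : omegaX k.+1 ('X_i * f) -> omegaX k f.
Proof.
move=> /omegaXP h; apply/omegaXP => e lt_e.
have := h (e + U_(i))%MM; rewrite mdegD mdeg1 addn1 ltnS => /(_ lt_e).
by rewrite mcoeff_XM mnmDE mnm1E eqxx addn1 /= addmK.
Qed.

(** The representative of degree below k of a class modulo omega^k. It turns congruences into
    equalities, so that the rewriting rules for linear maps apply. *)
Definition mtrunc (k : nat) f := mdiag (fun e => (mdeg e < k)%:R) f.

HB.instance Definition _ k := GRing.isLinear.Build K {mpoly K[m]} {mpoly K[m]} _ (mtrunc k) (mext_linear _).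

Lemma mcoeff_mtrunc k f e : (mtrunc k f)@_e = if (mdeg e < k)%N then f@_e else 0.
Proof. by rewrite mcoeff_mdiag; case: ifP; rewrite ?mul1r ?mul0r. Qed.

Lemma msize_mtrunc k f : (msize (mtrunc k f) <= k)%N.
Proof.
rewrite msizeE big_seq; apply: (big_ind (fun x => x <= k)%N) => //.
  by move=> a b ha hb; rewrite geq_max ha.
by move=> e; rewrite mcoeff_msupp mcoeff_mtrunc; case: ifP => //; rewrite eqxx.
Qed.

Lemma mtrunc_eqmodX k f : eqmodX k (mtrunc k f) f.
Proof. by apply/omegaXP => e lt_e; rewrite mcoeffB mcoeff_mtrunc lt_e subrr. Qed.

Lemma eqmodX_mtrunc k f g : eqmodX k f g <-> mtrunc k f = mtrunc k g.
Proof.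
split=> [/omegaXP h|h].
  apply/mpolyP => e; rewrite !mcoeff_mtrunc; case: ifP => // lt_e.
  by apply/eqP; rewrite -subr_eq0 -mcoeffB h.
apply/omegaXP => e lt_e; rewrite mcoeffB.
by have := congr1 (mcoeff e) h; rewrite !mcoeff_mtrunc lt_e => ->; rewrite subrr.
Qed.

(** A variable raises the degree by one, so the bound k on the entries is the bound k + 1 on the
    sum. In particular, truncating an exact syzygy gives an exact syzygy. *)
Lemma mtrunc_sumX k (A : 'I_m -> {mpoly K[m]}) :
  \sum_i 'X_i * mtrunc k (A i) = mtrunc k.+1 (\sum_i 'X_i * A i).
Proof.
apply/mpolyP => e; rewrite mcoeff_mtrunc !raddf_sum /=.
case: ifP => lt_e; last first.
  rewrite big1 // => i _; rewrite mcoeff_XM; case: ifP => // ei.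
  rewrite mcoeff_mtrunc; case: ifP => // lt_e'; move: lt_e.
  suff -> : (mdeg e < k.+1)%N by [].
  by rewrite -(submK (mnm1_le ei)) mdegD mdeg1 addn1.
apply: eq_bigr => i _; rewrite !mcoeff_XM; case: ifP => // ei.
have E : mdeg e = (mdeg (e - U_(i))%MM).+1 by rewrite -{1}(submK (mnm1_le ei)) mdegD mdeg1 addn1.
by rewrite mcoeff_mtrunc; move: lt_e; rewrite E ltnS => ->.
Qed.

End OmegaPowers.

(** * Jacobians in the free metabelian nilpotent Lie algebra *)

Section LieComplements.
Variables (K : fieldType) (L : lieAlgType K).
Implicit Types u v w : L.

Lemma lie_suml (I : Type) (r : seq I) (P : pred I) (F : I -> L) w :
  lie (\sum_(i <- r | P i) F i) w = \sum_(i <- r | P i) lie (F i) w.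
Proof. exact: (big_morph (lie^~ w) (fun u v => lieDl u v w) (lie0l w)). Qed.

Lemma lie_sumr (I : Type) (r : seq I) (P : pred I) (F : I -> L) w :
  lie w (\sum_(i <- r | P i) F i) = \sum_(i <- r | P i) lie w (F i).
Proof. exact: (big_morph (lie w) (fun u v => lieDr u v w) (lie0r w)). Qed.

Lemma derived_lie u v : derived L (lie u v).
Proof.
rewrite -[lie u v]scale1r -[_ *: _]addr0.
by apply: spanP; [exists u, v | exact: span0].
Qed.

Lemma ideal_sum (J : lie_ideal L) (I : Type) (r : seq I) (P : pred I) (F : I -> L) :
  (forall i, P i -> J (F i)) -> J (\sum_(i <- r | P i) F i).
Proof.
move=> h; elim/big_rec: _ => [|i x Pi Jx]; first exact: ideal0.
by apply: idealD => //; apply: h.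
Qed.

Lemma idealB (J : lie_ideal L) u v : J u -> J v -> J (u - v).
Proof. by move=> Ju Jv; apply/idealD/idealN. Qed.

Lemma lcsW k n u : lcs L (k + n).+1 u -> lcs L k.+1 u.
Proof.
elim: n => [|n IH]; rewrite ?addn0 // addnS lcsS // => h; apply: IH.
by elim: h => [|a w z [p [q [lp _ ->]]] _ lz];
  [apply: ideal0 | apply: idealP => //; apply: ideal_lie].
Qed.

Lemma lcs_lie k u v : lcs L k.+1 u -> lcs L k.+2 (lie u v).
Proof.
move=> lu; rewrite lcsS // -[lie u v]scale1r -[_ *: _]addr0.
by apply: spanP; [exists u, v | exact: span0].
Qed.

End LieComplements.

Section LieHom.
Variables (K : fieldType) (L M N : lieAlgType K).

Lemma lie_homD (f : L -> M) u v : lie_hom f -> f (u + v) = f u + f v.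
Proof. by move=> [lin _]; have := lin 1 u v; rewrite !scale1r. Qed.

Lemma lie_hom0 (f : L -> M) : lie_hom f -> f 0 = 0.
Proof. by move=> h; apply: (addrI (f 0)); rewrite -lie_homD // !addr0. Qed.

Lemma lie_homB (f : L -> M) u v : lie_hom f -> f (u - v) = f u - f v.
Proof. by move=> h; rewrite addrC -!scaleN1r (proj1 h) addrC. Qed.

Lemma lie_hom_comp (g : M -> N) (f : L -> M) :
  lie_hom g -> lie_hom f -> lie_hom (g \o f).
Proof.
move=> [glin glie] [flin flie]; split=> [a|] u v /=; first by rewrite flin glin.
by rewrite flie glie.
Qed.

Lemma lie_hom_lcs (f : L -> M) k u : lie_hom f -> lcs L k.+1 u -> lcs M k.+1 (f u).
Proof.
move=> h; elim: k u => // k IH u; rewrite {1}lcsS //.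
elim=> [|a w z [p [q [lp _ ->]]] _ lz]; first by rewrite lie_hom0 //; apply: ideal0.
rewrite (proj1 h); apply: idealP => //; rewrite (proj2 h).
by apply: lcs_lie; apply: IH.
Qed.

Lemma lie_hom_derived (f : L -> M) u : lie_hom f -> derived L u -> derived M (f u).
Proof. exact: (@lie_hom_lcs f 1). Qed.

Lemma lie_hom_derived2 (f : L -> M) u : lie_hom f -> derived2 L u -> derived2 M (f u).
Proof.
move=> h; elim=> [|a w z [p [q [dp dq ->]]] _ lz]; first by rewrite lie_hom0 //; apply: ideal0.
rewrite (proj1 h) (proj2 h); apply: spanP => //.
by exists (f p), (f q); split=> //; apply: lie_hom_derived.
Qed.

End LieHom.

Section Span.
Variables (K : fieldType) (V : lmodType K) (S : V -> Prop).

Lemma span_mem u : S u -> span S u.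
Proof. by move=> Su; rewrite -[u]scale1r -[_ *: _]addr0; apply: spanP => //; apply: span0. Qed.

Lemma spanD u v : span S u -> span S v -> span S (u + v).
Proof. by move=> *; rewrite -[u]scale1r; apply: spanZD. Qed.

Lemma spanZ a u : span S u -> span S (a *: u).
Proof. by move=> *; rewrite -[_ *: _]addr0; apply: spanZD => //; apply: span0. Qed.

Lemma span_sum (I : Type) (r : seq I) (P : pred I) (F : I -> V) :
  (forall i, P i -> span S (F i)) -> span S (\sum_(i <- r | P i) F i).
Proof.
move=> h; elim/big_rec: _ => [|i x Pi Jx]; first exact: span0.
by apply: spanD => //; apply: h.
Qed.

End Span.

Lemma mnm_ind m (P : 'X_{1..m} -> Prop) :
  P 0%MM -> (forall e i, P e -> P (e + U_(i))%MM) -> forall e, P e.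
Proof.
move=> P0 PS e; have [n] := ubnP (mdeg e); elim: n e => // n IH e.
have [/eqP|e_pos] := posnP (mdeg e); first by rewrite mdeg_eq0 => /eqP ->.
have [[i ei]|/forallNP h] := pselect (exists i, (0 < e i)%N); last first.
  by move: e_pos; rewrite mdegE big1 // => i _; apply/eqP; rewrite eqn0Ngt; apply/negP/h.
rewrite -(submK (mnm1_le ei)) mdegD mdeg1 addn1 ltnS => /IH.
exact: PS.
Qed.

(** * The commutator ideal and the partial derivatives *)

Section FreeMetabelian.
Variables (K : fieldType) (m c : nat).
Local Notation LL := (Lmc K m c).
Local Notation y := (@gen K m c).
Local Notation poly := {mpoly K[m]}.
Implicit Types (u v w x : LL) (e : 'X_{1..m}).

Lemma Lm_ind (P : Lm K m -> Prop) :
  P 0 -> (forall a (u v : Lm K m), P u -> P v -> P (a *: u + v)) ->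
  (forall u v : Lm K m, P u -> P v -> P (lie u v)) ->
  (forall i, P (free_gen K i)) -> forall z, P z.
Proof.
move=> P0 Plin Plie Pgen; elim/quotW.
elim=> [i||s IHs t IHt|a s IHs|s IHs t IHt].
- exact: Pgen.
- exact: P0.
- by rewrite -fl_addE -[X in P X]/(_ + _ : Lm K m) -[X in P (X + _)]scale1r; apply: Plin.
- by rewrite -fl_scaleE -[X in P X]addr0; apply: Plin.
- by rewrite -fl_lieE; apply: Plie.
Qed.

Lemma quot_pi_repr x : quot_pi (Lmc_ideal K m c) (repr x) = x.
Proof. by rewrite /quot_pi reprK. Qed.

Lemma Lmc_ind (P : LL -> Prop) :
  P 0 -> (forall a u v, P u -> P v -> P (a *: u + v)) ->
  (forall u v, P u -> P v -> P (lie u v)) ->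
  (forall i, P (y i)) -> forall x, P x.
Proof.
move=> P0 Plin Plie Pgen x; rewrite -(quot_pi_repr x).
have hom := quot_pi_hom (Lmc_ideal K m c); have [lin hlie] := hom.
elim/Lm_ind: (repr x) => [|a u v Pu Pv|u v Pu Pv|i].
- by rewrite lie_hom0.
- by rewrite lin; apply: Plin.
- by rewrite hlie; apply: Plie.
- exact: Pgen.
Qed.

Lemma Lmc_metabelian u v : derived LL u -> derived LL v -> lie u v = 0.
Proof.
(* The derived ideal is the second term of the lower central series, so [lcs_lift] at 1 lifts both
   factors into the derived ideal of the free Lie algebra. *)
move=> /(@lcs_lift _ _ _ 1)[p dp ->] /(@lcs_lift _ _ _ 1)[q dq ->].
have [_ <-] := quot_pi_hom (Lmc_ideal K m c).
apply/Defs.quotP; rewrite subr0; exists (lie p q), 0; rewrite addr0; split=> //; last exact: ideal0.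
by apply: span_mem; exists p, q.
Qed.

Lemma ad_comm u v w : derived LL w -> ad u (ad v w) = ad v (ad u w).
Proof.
by move=> dw; rewrite /ad lie_der (Lmc_metabelian dw (derived_lie _ _)) addr0.
Qed.

Lemma iter_ad_derived k u w : derived LL w -> derived LL (iter k (ad u) w).
Proof. by move=> dw; elim: k => //= k _; apply: derived_lie. Qed.

Lemma iter_ad_comm k u v w :
  derived LL w -> iter k (ad u) (ad v w) = ad v (iter k (ad u) w).
Proof.
by move=> dw; elim: k => //= k ->; rewrite ad_comm //; apply: iter_ad_derived.
Qed.

Section AdMonom.
Implicit Type s : seq 'I_m.
(** [ad_monom] with an arbitrary list of indices, so that induction on the list is possible. In a
    duplicate-free list a new factor [ad (y j)] enters at one place only, and commutativity moves it
    to the front. *)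
Let adm s e w := foldl (fun w i => iter (e i) (ad (y i)) w) w s.

Let adm_derived s e w : derived LL w -> derived LL (adm s e w).
Proof. by elim: s w => //= i s IH w dw; apply: IH; apply: iter_ad_derived. Qed.

Let adm_comm s e u w : derived LL w -> adm s e (ad u w) = ad u (adm s e w).
Proof.
elim: s w => //= i s IH w dw; rewrite iter_ad_comm //.
by apply: IH; apply: iter_ad_derived.
Qed.

Let admS s e j w : uniq s -> derived LL w ->
  adm s (e + U_(j))%MM w = if j \in s then ad (y j) (adm s e w) else adm s e w.
Proof.
elim: s w => //= i s IH w /andP[i_s us] dw.
rewrite IH //; last exact: iter_ad_derived.
rewrite inE mnmDE mnm1E; case: eqP => [->|_] /=; last by rewrite addn0.
rewrite (negbTE i_s) addn1 /= -adm_comm //; exact: iter_ad_derived.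
Qed.

Lemma ad_monom_derived e w : derived LL w -> derived LL (ad_monom e w).
Proof. exact: adm_derived. Qed.

Lemma ad_monom_ad e u w : derived LL w -> ad_monom e (ad u w) = ad u (ad_monom e w).
Proof. exact: adm_comm. Qed.

Lemma ad_monomS e j w : derived LL w ->
  ad_monom (e + U_(j))%MM w = ad (y j) (ad_monom e w).
Proof. by move=> dw; rewrite /ad_monom -/(adm _ _ _) admS ?enum_uniq // mem_enum. Qed.

End AdMonom.

Lemma ad_monom0 w : ad_monom 0%MM w = w.
Proof. by rewrite /ad_monom; elim: (enum _) w => //= i s IH w; rewrite mnm0E. Qed.

Lemma ad_linear u : linear (ad u : LL -> LL).
Proof. exact: lie_linearl. Qed.

Lemma iter_ad_linear k u : linear (iter k (ad u) : LL -> LL).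
Proof. by move=> a v w; elim: k => //= k ->; rewrite ad_linear. Qed.

Lemma ad_monom_linear e : linear (@ad_monom K m c e).
Proof.
rewrite /ad_monom => a v w; elim: (enum _) v w => //= i s IH v w.
by rewrite iter_ad_linear IH.
Qed.

HB.instance Definition _ e := GRing.isLinear.Build K LL LL _ (ad_monom e) (ad_monom_linear e).
HB.instance Definition _ u := GRing.isLinear.Build K LL LL _ (ad u) (ad_linear u).

Lemma ad_monom_lcs k e w : derived LL w -> lcs LL k.+1 w -> lcs LL (k + mdeg e).+1 (ad_monom e w).
Proof.
move=> dw lw; elim/mnm_ind: e => [|e i IH]; first by rewrite mdeg0 addn0 ad_monom0.
by rewrite ad_monomS // mdegD mdeg1 addn1 addnS; apply: lcs_lie.
Qed.

(** The element is a commutator of length [mdeg e + 2], which exceeds the nilpotency class c. *)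
Lemma ad_monom_eq0 e u v : (c <= (mdeg e).+1)%N -> ad_monom e (lie u v) = 0.
Proof.
move=> le_c; apply: lcs_Lmc_eq0; apply: (@lcsW _ _ _ ((mdeg e).+1 - c)).
rewrite subnKC // -[(mdeg e).+1]add1n.
by apply: ad_monom_lcs; [exact: derived_lie | apply: lcs_lie].
Qed.

Hypothesis c_gt0 : (0 < c)%N.

(** The linear component of [x] with each y_r replaced by t_r. For positive c all relations lie in
    the derived ideal, so the choice of a lift does not matter. *)
Definition lpart x : poly := wr_t (eps_free (repr x)).2.

Lemma Lmc_ideal_derived (z : Lm K m) : Lmc_ideal K m c z -> derived (Lm K m) z.
Proof.
move=> [p [q [dp lq ->]]]; apply: idealD.
  by elim: dp => [|a w v [r [s [_ _ ->]]] _ dv];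
    [apply: ideal0 | apply: idealP => //; apply: derived_lie].
have : lcs (Lm K m) (1 + c.-1).+1 q by rewrite add1n prednK.
exact: lcsW.
Qed.

Lemma lpartE (z : Lm K m) x : quot_pi (Lmc_ideal K m c) z = x ->
  lpart x = wr_t (eps_free z).2.
Proof.
move=> <-; rewrite /lpart; congr wr_t; apply/eqP; rewrite -subr_eq0.
have -> (a b : wreath K m) : a.2 - b.2 = (a - b).2 by [].
by rewrite -eps_freeB eps_free_derived //; apply/Lmc_ideal_derived/quot_repr.
Qed.

Lemma pd_lift i (z : Lm K m) x : quot_pi (Lmc_ideal K m c) z = x ->
  eqmodX c (pd i x) ((eps_free z).1 i).
Proof. by move=> /(pdE i); rewrite /fox epsE. Qed.

Lemma pd_repr i x : pd i x = (eps_free (repr x)).1 i.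
Proof. by rewrite /pd /fox epsE. Qed.

Lemma lpart_linear : linear lpart.
Proof.
move=> a u v; have [lin _] := quot_pi_hom (Lmc_ideal K m c).
rewrite (@lpartE (a *: repr u + repr v)) ?lin ?quot_pi_repr //.
by rewrite /eps_free (proj1 (free_lift_hom _)) /= wr_t_lin.
Qed.

Lemma lpart_lie u v : lpart (lie u v) = 0.
Proof.
have [_ hl] := quot_pi_hom (Lmc_ideal K m c).
rewrite (@lpartE (lie (repr u) (repr v))) ?hl ?quot_pi_repr //.
by rewrite /eps_free (proj2 (free_lift_hom _)) /= wr_t0.
Qed.

Lemma wr_t_delta i : wr_t [ffun k => (k == i)%:R : K^o] = 'X_i :> poly.
Proof.
rewrite /wr_t (bigD1 i) //= ffunE eqxx scale1r big1 ?addr0 // => j /negbTE ji.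
by rewrite ffunE ji scale0r.
Qed.

Lemma lpart_gen i : lpart (y i) = 'X_i.
Proof. by rewrite (lpartE (erefl (y i))) /eps_free free_lift_gen /= wr_t_delta. Qed.

HB.instance Definition _ := GRing.isLinear.Build K LL poly _ lpart lpart_linear.

Lemma lpart_derived u : derived LL u -> lpart u = 0.
Proof.
elim=> [|a w z [p [q [_ _ ->]]] _ IH]; first by rewrite linear0.
by rewrite linearP /= lpart_lie scaler0 add0r.
Qed.

Lemma pd_linear_mod i a u v : eqmodX c (pd i (a *: u + v)) (a *: pd i u + pd i v).
Proof.
have [lin _] := quot_pi_hom (Lmc_ideal K m c).
have := @pd_lift i (a *: repr u + repr v) (a *: u + v).
rewrite lin !quot_pi_repr => /(_ erefl).
by rewrite /eps_free (proj1 (free_lift_hom _)) /= !ffunE -/(eps_free _) -!pd_repr.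
Qed.

(** The Leibniz rule of Fox calculus, read off from the bracket of the wreath product. *)
Lemma pd_lie i u v : eqmodX c (pd i (lie u v)) (pd i u * lpart v - pd i v * lpart u).
Proof.
have [_ hl] := quot_pi_hom (Lmc_ideal K m c).
have := @pd_lift i (lie (repr u) (repr v)) (lie u v).
rewrite hl !quot_pi_repr => /(_ erefl).
by rewrite /eps_free (proj2 (free_lift_hom _)) /= !ffunE -!/(eps_free _) -!pd_repr.
Qed.

Lemma pd_gen i j : eqmodX c (pd i (y j)) (i == j)%:R.
Proof.
have := pd_lift i (erefl (y j)).
by rewrite /eps_free free_lift_gen /= ffunE.
Qed.

(** The fundamental identity of Fox calculus. It holds exactly, since both sides are computed from
    the same lift; for a bracket the two terms cancel by commutativity of polynomials. *)
Lemma fox_identity x : \sum_i 'X_i * pd i x = lpart x.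
Proof.
under eq_bigr do rewrite pd_repr.
have [lin hl] := free_lift_hom (@wr_gen K m).
rewrite /lpart; elim/Lm_ind: (repr x) => [|a u v Pu Pv|u v Pu Pv|i].
- rewrite /eps_free lie_hom0 // wr_t0 big1 // => i _; by rewrite ffunE mulr0.
- rewrite /eps_free lin /= wr_t_lin -!/(eps_free _) -Pu -Pv scaler_sumr -big_split.
  by apply: eq_bigr => i _; rewrite !ffunE /= mulrDr scalerAr.
- rewrite /eps_free hl /= wr_t0 -!/(eps_free _).
  under eq_bigr do rewrite ffunE mulrBr !mulrA.
  by rewrite sumrB -!mulr_suml Pu Pv mulrC subrr.
- rewrite /eps_free free_lift_gen /= wr_t_delta (bigD1 i) //= ffunE eqxx mulr1.
  by rewrite big1 ?addr0 // => j /negbTE ji; rewrite ffunE ji mulr0.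
Qed.

(** Since [pd] depends on a chosen lift, it is linear only modulo omega^c; its truncation is linear
    on the nose. *)
Definition tpd i x : poly := mtrunc c (pd i x).

Lemma tpd_linear i : linear (tpd i).
Proof. by move=> a u v; rewrite /tpd -linearP; apply/eqmodX_mtrunc/pd_linear_mod. Qed.

HB.instance Definition _ i := GRing.isLinear.Build K LL poly _ (tpd i) (tpd_linear i).

Lemma tpdE i x f : tpd i x = mtrunc c f <-> eqmodX c (pd i x) f.
Proof. by split=> /eqmodX_mtrunc. Qed.

Lemma pd_ad i u w : derived LL w -> eqmodX c (pd i (ad u w)) (lpart u * pd i w).
Proof.
move=> dw; have := pd_lie i w u.
by rewrite (lpart_derived dw) mulr0 subr0 mulrC.
Qed.

Lemma pd_iter_ad i u k w : derived LL w ->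
  eqmodX c (pd i (iter k (ad u) w)) (lpart u ^+ k * pd i w).
Proof.
move=> dw; elim: k => [|k IH] /=; first by rewrite mul1r /eqmodX subrr; apply: omegaX0.
apply: eqmodX_trans (pd_ad _ _ (iter_ad_derived _ _ dw)) _.
by rewrite exprS -mulrA; apply: eqmodX_mull.
Qed.

Lemma pd_ad_monom i e w : derived LL w -> eqmodX c (pd i (ad_monom e w)) ('X_[e] * pd i w).
Proof.
move=> dw; elim/mnm_ind: e => [|e j IH].
  by rewrite ad_monom0 mpolyX0 mul1r /eqmodX subrr; apply: omegaX0.
rewrite ad_monomS //; apply: eqmodX_trans (pd_ad _ _ (ad_monom_derived _ dw)) _.
by rewrite lpart_gen mpolyXD ['X_[e] * _]mulrC -mulrA; apply: eqmodX_mull.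
Qed.

Lemma pd_lie_gen i p q :
  eqmodX c (pd i (lie (y p) (y q))) ((i == p)%:R * 'X_q - (i == q)%:R * 'X_p).
Proof.
apply: eqmodX_trans (pd_lie _ _ _) _; rewrite !lpart_gen /eqmodX.
rewrite (_ : _ - _ = (pd i (y p) - (i == p)%:R) * 'X_q - (pd i (y q) - (i == q)%:R) * 'X_p); last ring.
by apply: omegaXB; apply/omegaXM/pd_gen.
Qed.

Definition basic_commutator x := exists e p q, x = ad_monom e (lie (y p) (y q)).

Lemma span_basic_ad j x : span basic_commutator x -> span basic_commutator (ad (y j) x).
Proof.
elim=> [|a u v [e [p [q ->]]] _ IH]; first by rewrite linear0; apply: span0.
rewrite linearP; apply: spanP IH; exists (e + U_(j))%MM, p, q.
by rewrite ad_monomS //; apply: derived_lie.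
Qed.

Lemma span_basic_derived x : span basic_commutator x -> derived LL x.
Proof.
elim=> [|a u v [e [p [q ->]]] _ IH]; first exact: ideal0.
by apply: idealP => //; apply/ad_monom_derived/derived_lie.
Qed.

(** Induction over Lie expressions. In a bracket, two commutator parts give zero by the metabelian
    law, a commutator part against a linear part receives one more [ad (y j)], and two linear parts
    give brackets of generators. *)
Lemma Lmc_decomposition x :
  exists b : 'I_m -> K, span basic_commutator (x - \sum_i b i *: y i).
Proof.
elim/Lmc_ind: x => [|a u v [b bu] [d dv]|u v [b bu] [d dv]|i].
- exists (fun=> 0); rewrite big1 ?subr0; first exact: span0.
  by move=> i _; rewrite scale0r.
- exists (fun i => a * b i + d i).
  rewrite (_ : _ - _ = a *: (u - \sum_i b i *: y i) + (v - \sum_i d i *: y i)); first exact: spanZD.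
  rewrite scalerBr addrACA -opprD; congr (_ - _); rewrite scaler_sumr -big_split /=.
  by apply: eq_bigr => i _; rewrite scalerA scalerDl.
- exists (fun=> 0); rewrite big1 ?subr0; last by move=> i _; rewrite scale0r.
  set s := \sum_i b i *: y i in bu; set t := \sum_i d i *: y i in dv.
  have bs (z : LL) (h : 'I_m -> K) : span basic_commutator z ->
      span basic_commutator (lie z (\sum_i h i *: y i)).
    move=> bz; rewrite lie_sumr; apply: span_sum => i _.
    by rewrite lieZr; apply/spanZ/span_basic_ad.
  rewrite -[u](subrK s) lieDl -[v](subrK t) lieDr.
  rewrite (Lmc_metabelian (span_basic_derived bu) (span_basic_derived dv)) add0r.
  apply: spanD; first exact: bs.
  rewrite lieDr; apply: spanD.
    by rewrite lie_anti -scaleN1r; apply/spanZ/bs.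
  rewrite lie_sumr; apply: span_sum => j _; rewrite lieZr lie_suml; apply: spanZ.
  apply: span_sum => i _; rewrite lieZl; apply/spanZ/span_mem.
  by exists 0%MM, i, j; rewrite ad_monom0.
- exists (fun j => (j == i)%:R); rewrite (bigD1 i) //= eqxx scale1r big1; last first.
    by move=> j /negbTE ->; rewrite scale0r.
  by rewrite addr0 subrr; apply: span0.
Qed.

Lemma lpart_gens (b : 'I_m -> K) : lpart (\sum_i b i *: y i) = \sum_i b i *: 'X_i.
Proof. by rewrite linear_sum; apply: eq_bigr => i _; rewrite linearZ /= lpart_gen. Qed.

Lemma mcoeff_lin (b : 'I_m -> K) i : (\sum_j b j *: 'X_j : poly)@_U_(i) = b i.
Proof.
rewrite raddf_sum (bigD1 i) //= mcoeffZ mcoeffXU eqxx mulr1.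
by rewrite big1 ?addr0 // => j /negbTE ji; rewrite mcoeffZ mcoeffXU ji mulr0.
Qed.

Lemma lpart_eq0_basic x : lpart x = 0 -> span basic_commutator x.
Proof.
move=> x0; have [b bx] := Lmc_decomposition x.
have /lpart_derived := span_basic_derived bx.
rewrite linearB /= x0 sub0r lpart_gens => /eqP; rewrite oppr_eq0 => /eqP b0.
move: bx; rewrite big1 ?subr0 // => i _.
by rewrite -[b i]mcoeff_lin b0 mcoeff0 scale0r.
Qed.

Lemma lpart_eq0_derived x : lpart x = 0 -> derived LL x.
Proof. by move/lpart_eq0_basic/span_basic_derived. Qed.

Lemma derived_basic x : derived LL x -> span basic_commutator x.
Proof. by move/lpart_derived/lpart_eq0_basic. Qed.

End FreeMetabelian.

(** * The Euler homotopy *)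

Section Euler.
Variables (K : fieldType) (charK0 : [pchar K] =i pred0) (m c : nat) (c_gt0 : (0 < c)%N).
Local Notation LL := (Lmc K m c).
Local Notation y := (@gen K m c).
Local Notation poly := {mpoly K[m]}.
Implicit Types (u v w x : LL) (e : 'X_{1..m}) (A B : 'I_m -> poly).

Lemma natS_neq0 n : n.+1%:R != 0 :> K.
Proof. by move/pcharf0P: charK0 => ->. Qed.

Lemma mnm_addUB e i j : (0 < e j)%N -> (e + U_(i) - U_(j) = e - U_(j) + U_(i))%MM.
Proof.
move=> ej; apply/mnmP => l; rewrite !(mnmDE, mnmBE, mnm1E).
by case: (eqVneq j l) => [<-|_] /=; rewrite ?subn0 // addnBAC.
Qed.

(** The Leibniz rule for the derivative of t_q t^e with respect to t_j, with monomials replaced by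
    any function of the exponent. *)
Lemma scale_mnm_shift (V : lmodType K) (F : 'X_{1..m} -> V) e q j :
  ((e + U_(q))%MM j)%:R *: F (e + U_(q) - U_(j))%MM =
    (e j)%:R *: F (e - U_(j) + U_(q))%MM + (q == j)%:R *: F e.
Proof.
rewrite mnmDE mnm1E natrD scalerDl; congr (_ + _).
  by case: (posnP (e j)) => [->|ej]; rewrite ?scale0r // mnm_addUB.
by case: eqP => [->|_]; rewrite ?scale0r // addmK.
Qed.

(** The value of the homotopy on the vector with t^e in position i and zero elsewhere. When [e j] is
    zero, the coefficient removes the meaningless exponent [e - U_(j)]. *)
Definition euler_term (i : 'I_m) e : LL :=
  (mdeg e).+1%:R^-1 *: \sum_j (e j)%:R *: ad_monom (e - U_(j))%MM (lie (y i) (y j)).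

Definition euler_lift A : LL := \sum_i mext (euler_term i) (A i).

Lemma euler_lift_linear a A B :
  euler_lift (fun i => a *: A i + B i) = a *: euler_lift A + euler_lift B.
Proof.
rewrite /euler_lift scaler_sumr -big_split /=.
by apply: eq_bigr => i _; rewrite linearP.
Qed.

Lemma euler_lift_derived A : derived LL (euler_lift A).
Proof.
apply: ideal_sum => i _; apply: ideal_sum => e _; apply/idealZ/idealZ.
by apply: ideal_sum => j _; apply/idealZ/ad_monom_derived/derived_lie.
Qed.

(** Differentiation lowers the degree by one and the bracket adds two, so monomials of degree at
    least c yield commutators of length above c. *)
Lemma euler_lift_eq0 A : (forall i, omegaX c (A i)) -> euler_lift A = 0.
Proof.
move=> oA; rewrite /euler_lift big1 // => i _; rewrite /mext big_seq big1 // => e.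
rewrite mcoeff_msupp => Ae; have {Ae} le_ce : (c <= mdeg e)%N.
  by rewrite leqNgt; apply: contra Ae => lt_e; apply/eqP; apply: (omegaXP _ _).1 (oA i) _ _.
rewrite /euler_term big1 ?scaler0 // => j _.
case: (posnP (e j)) => [->|ej]; first by rewrite scale0r.
rewrite ad_monom_eq0 ?scaler0 //.
by move: le_ce; rewrite -{1}(submK (mnm1_le ej)) mdegD mdeg1 addn1.
Qed.

Lemma euler_lift_eqmodX A B :
  (forall i, eqmodX c (A i) (B i)) -> euler_lift A = euler_lift B.
Proof.
move=> AB; apply/eqP; rewrite -subr_eq0 -scaleN1r addrC -euler_lift_linear.
rewrite euler_lift_eq0 // => i; rewrite scaleN1r addrC.
exact: AB.
Qed.

(** The derivatives [H] are the two monomials t^e t_q and -t^e t_p in positions p and q. The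
    homotopy returns the commutator [mdeg e + 2] times, [mdeg e] from differentiating t^e and 2 from
    differentiating t_q and t_p, and this cancels the denominator. *)
Lemma euler_lift_basic e p q : euler_lift (fun i => pd i (ad_monom e (lie (y p) (y q)))) =
  ad_monom e (lie (y p) (y q)).
Proof.
have dpq : derived LL (lie (y p) (y q)) by exact: derived_lie.
pose H i : poly := (i == p)%:R *: 'X_[e + U_(q)] - (i == q)%:R *: 'X_[e + U_(p)].
rewrite (@euler_lift_eqmodX _ H) => [|i]; last first.
  apply: eqmodX_trans (pd_ad_monom c_gt0 _ _ dpq) _.
  have -> : H i = 'X_[e] * ((i == p)%:R * 'X_q - (i == q)%:R * 'X_p).
    by rewrite /H !mpolyXD !scaler_nat mulrBr !mulr_natl !mulrnAr.
  exact/eqmodX_mull/pd_lie_gen.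
have pick (r : 'I_m) (F : 'I_m -> LL) : \sum_i (i == r)%:R *: F i = F r.
  rewrite (bigD1 r) //= eqxx scale1r big1 ?addr0 // => i /negbTE ->.
  by rewrite scale0r.
rewrite /euler_lift /H.
under eq_bigr do rewrite linearB !linearZ /= !mextX.
rewrite big_split /= !pick /euler_term !mdegD !mdeg1 !addn1 -scalerBr -sumrB.
(* The terms with a derivative of t^e combine by the Jacobi identity [[y_p, y_l], y_q] -
   [[y_q, y_l], y_p] = [[y_p, y_q], y_l], and the factor [ad (y l)] restores the full monomial
   t^e. *)
have E l : ((e + U_(q))%MM l)%:R *: ad_monom (e + U_(q) - U_(l))%MM (lie (y p) (y l)) -
   ((e + U_(p))%MM l)%:R *: ad_monom (e + U_(p) - U_(l))%MM (lie (y q) (y l)) =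
   (e l)%:R *: ad_monom e (lie (y p) (y q)) +
   ((q == l)%:R *: ad_monom e (lie (y p) (y l)) -
    (p == l)%:R *: ad_monom e (lie (y q) (y l))).
  rewrite (scale_mnm_shift (fun d => ad_monom d (lie (y p) (y l)))).
  rewrite (scale_mnm_shift (fun d => ad_monom d (lie (y q) (y l)))).
  rewrite opprD addrACA; congr (_ + _); rewrite -scalerBr.
  case: (posnP (e l)) => [->|el]; first by rewrite !scale0r.
  congr (_ *: _); rewrite !ad_monomS; try exact: derived_lie.
  rewrite -!ad_monom_ad; try exact: derived_lie.
  rewrite -raddfB /= -[in RHS](submK (mnm1_le el)) ad_monomS // -ad_monom_ad //.
  congr (ad_monom _ _); rewrite /ad lie_der [lie (y p) (lie _ _)]lie_anti.
  by rewrite [lie (y l) (y q)]lie_anti lieNl opprK addrK.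
under eq_bigr do rewrite E.
rewrite big_split /= -scaler_suml sumrB.
under [X in _ + (X - _)]eq_bigr do rewrite eq_sym.
under [X in _ + (_ - X)]eq_bigr do rewrite eq_sym.
rewrite (pick q (fun l => ad_monom e (lie (y p) (y l)))).
rewrite (pick p (fun l => ad_monom e (lie (y q) (y l)))).
rewrite [lie (y q) (y p)]lie_anti raddfN opprK -natr_sum -mdegE.
rewrite -[X in _ *: (_ + (X + _))]scale1r -[X in _ *: (_ + (_ + X))]scale1r -!scalerDl.
rewrite -[1]/(1%:R) -!natrD !addn1 addn2 scalerA mulVf ?scale1r //.
exact: natS_neq0.
Qed.

(** By linearity, basic commutators suffice. That [pd] is linear only modulo omega^c does no harm,
    since the lift depends only on classes modulo omega^c. *)
Lemma euler_lift_pd x : derived LL x -> euler_lift (fun i => pd i x) = x.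
Proof.
move/(derived_basic c_gt0); elim=> [|a u v [e [p [q ->]]] _ IH].
  rewrite euler_lift_eq0 // => i.
  have /tpdE : tpd i (0 : LL) = mtrunc c 0 by rewrite !linear0.
  by rewrite /eqmodX subr0.
rewrite -{2}IH -{2}(euler_lift_basic e p q) -euler_lift_linear.
by apply: euler_lift_eqmodX => i; apply: pd_linear_mod.
Qed.

(** The Fox identity puts the linear part of [x] into omega^2; being a linear form, it vanishes. *)
Lemma pd_omega_derived x : (forall i, omegaX 1 (pd i x)) -> derived LL x.
Proof.
move=> h; apply: (lpart_eq0_derived c_gt0); have ol : omegaX 2 (lpart x).
  rewrite -fox_identity; apply: omegaX_sum => i _.
  by apply: (@omegaX_mul _ _ 1 1) => //; apply/omega_omegaX1/omega_X.
apply: omegaX_small ol; rewrite /lpart /wr_t.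
rewrite msizeE big_seq; apply: (big_ind (fun n => n <= 2)%N) => // [a b ha hb|e].
  by rewrite geq_max ha.
rewrite mcoeff_msupp raddf_sum /=; apply: contraR; rewrite ltnS -ltnNge => lt_e.
rewrite big1 // => j _; rewrite mcoeffZ mcoeffX; case: eqP => [E|_]; last by rewrite mulr0.
by move: lt_e; rewrite -E mdeg1.
Qed.

Lemma pd_eq0 x : (forall i, eqmodX c (pd i x) 0) -> x = 0.
Proof.
move=> h; have h' i : omegaX c (pd i x) by have := h i; rewrite /eqmodX subr0.
have dx : derived LL x by apply: pd_omega_derived => i; apply: omegaXW (h' i).
by rewrite -(euler_lift_pd dx) euler_lift_eq0.
Qed.

Lemma pd_inj x x' : (forall i, eqmodX c (pd i x) (pd i x')) -> x = x'.
Proof.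
move=> h; apply/eqP; rewrite -subr_eq0; apply/eqP/pd_eq0 => i.
by apply/eqmodX_mtrunc; rewrite -/(tpd _ _) !linear0 linearB /= ((tpdE i x _).2 (h i)) subrr.
Qed.

(* Euler's formula: [d_k E (\sum_i X_i A_i)] vanishes on syzygies, where [E] divides
   each homogeneous component by its degree. *)
Lemma pd_euler_lift A k : \sum_i 'X_i * A i = 0 ->
  eqmodX c (pd k (euler_lift A)) (A k).
Proof.
move=> A0; apply/eqmodX_mtrunc; rewrite -/(tpd _ _).
(* At the constant monomial the factor is [0^-1 = 0]; this is harmless, as [D] is evaluated on
   multiples of variables. *)
pose D (f : poly) : poly := (mdiag (fun e => (mdeg e)%:R^-1) f)^`M(k).
(* The homotopy identity on a monomial vector: the derivative of the lift is the vector itself minus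
   a term that depends only on its contraction with the variables. *)
have tE i e : tpd k (euler_term i e) =
    mtrunc c ((k == i)%:R *: 'X_[e] - D ('X_i * 'X_[e])).
  rewrite /euler_term linearZ linear_sum /=.
  have -> : \sum_j tpd k ((e j)%:R *: ad_monom (e - U_(j)) (lie (y i) (y j))) =
      mtrunc c (\sum_j (e j)%:R *: ('X_[e - U_(j)] * ((k == i)%:R * 'X_j - (k == j)%:R * 'X_i))).
    rewrite linear_sum; apply: eq_bigr => j _; rewrite !linearZ /=; congr (_ *: _).
    apply/eqmodX_mtrunc/(eqmodX_trans (pd_ad_monom c_gt0 _ _ (derived_lie _ _))).
    exact/eqmodX_mull/pd_lie_gen.
  rewrite -linearZ; congr (mtrunc c _).
  have -> : D ('X_i * 'X_[e]) = (mdeg e).+1%:R^-1 *: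
     ((e k)%:R *: ('X_[e - U_(k)] * 'X_i) + (k == i)%:R *: 'X_[e]).
    rewrite /D mulrC -!mpolyXD /mdiag mextX mdegD mdeg1 addn1 linearZ /= mderivX.
    rewrite (scale_mnm_shift (fun d => 'X_[d] : poly)) eq_sym.
    by [].
  have -> : \sum_j (e j)%:R *: ('X_[e - U_(j)] * ((k == i)%:R * 'X_j - (k == j)%:R * 'X_i)) =
     (k == i)%:R *: ((mdeg e)%:R *: 'X_[e]) - (e k)%:R *: ('X_[e - U_(k)] * 'X_i) :> poly.
    have C (a b : K) (f : poly) : a *: (b *: f) = b *: (a *: f) by rewrite !scalerA mulrC.
    have N (f g : poly) (b : bool) : f * (b%:R * g) = b%:R *: (f * g).
      by case: b; rewrite ?mul1r ?scale1r // mul0r mulr0 scale0r.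
    have EE j : (e j)%:R *: ('X_[e - U_(j)] * ((k == i)%:R * 'X_j - (k == j)%:R * 'X_i)) =
       (k == i)%:R *: ((e j)%:R *: 'X_[e]) - (k == j)%:R *: ((e j)%:R *: ('X_[e - U_(j)] * 'X_i)) :> poly.
      rewrite mulrBr scalerBr; congr (_ - _); last first.
        by rewrite N [LHS]C.
      rewrite N [LHS]C.
      congr (_ *: _); case: (posnP (e j)) => [->|ej]; first by rewrite !scale0r.
      by rewrite -mpolyXD submK // mnm1_le.
    under eq_bigr do rewrite EE.
    rewrite sumrB -scaler_sumr -scaler_suml -natr_sum -mdegE; congr (_ - _).
    rewrite (bigD1 k) //= eqxx scale1r big1 ?addr0 // => j.
    by rewrite eq_sym => /negbTE ->; rewrite scale0r.
  have n0 := natS_neq0 (mdeg e); rewrite scalerBr [in RHS]scalerDr opprD [RHS]addrA addrAC.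
  congr (_ - _); apply: (scalerI n0); rewrite scalerBr !scalerA mulfV // !mul1r -scalerBl.
  congr (_ *: _); rewrite -[(mdeg e).+1]addn1 natrD.
  by rewrite mulrDl mul1r addrK mulrC.
have DS (I : Type) (r : seq I) (F : I -> poly) : D (\sum_(l <- r) F l) = \sum_(l <- r) D (F l).
  by rewrite /D (linear_sum (mdiag _)) (linear_sum (mderiv k)).
have DZ a (f : poly) : D (a *: f) = a *: D f by rewrite /D linearZ /= mderivZ.
have DX (f : poly) i : tpd k (mext (euler_term i) f) = mtrunc c ((k == i)%:R *: f - D ('X_i * f)).
  rewrite {2 3}[f]mpolyE /mext linear_sum /=.
  rewrite scaler_sumr mulr_sumr DS -sumrB linear_sum; apply: eq_bigr => e _.
  rewrite linearZ /= tE -linearZ /=; congr (mtrunc c _).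
  by rewrite -scalerAr DZ scalerBr !scalerA [_ * f@_e]mulrC.
rewrite /euler_lift linear_sum /=; under eq_bigr do rewrite DX.
rewrite -(linear_sum (mtrunc c)) sumrB; congr (mtrunc c _).
rewrite -DS A0 /D linear0 mderiv0 subr0.
rewrite (bigD1 k) //= eqxx scale1r big1 ?addr0 // => j.
by rewrite eq_sym => /negbTE ->; rewrite scale0r.
Qed.

End Euler.

(** * Endomorphisms and inner automorphisms *)

Section Endomorphisms.
Variables (K : fieldType) (m c : nat).
Local Notation LL := (Lmc K m c).
Local Notation y := (@gen K m c).
Implicit Types (u v w x : LL) (phi psi : LL -> LL).

Lemma lie_hom_gen_ext phi psi : lie_hom phi -> lie_hom psi ->
  (forall j, phi (y j) = psi (y j)) -> phi = psi.
Proof.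
move=> hphi hpsi E; apply/funext; elim/Lmc_ind => [|a u v Eu Ev|u v Eu Ev|//].
- by rewrite !lie_hom0.
- by rewrite (proj1 hphi) (proj1 hpsi) Eu Ev.
- by rewrite (proj2 hphi) (proj2 hpsi) Eu Ev.
Qed.

(** The extension to the free Lie algebra kills the defining ideal, because the target is itself
    metabelian and nilpotent of class c. *)
Lemma lie_hom_of_gens (w : 'I_m -> LL) :
  exists2 phi, lie_hom phi & forall j, phi (y j) = w j.
Proof.
have hl := free_lift_hom w; have [lin hlie] := hl.
have hpi := quot_pi_hom (Lmc_ideal K m c); have [plin plie] := hpi.
have kill z : Lmc_ideal K m c z -> free_lift w z = 0.
  move=> [p [q [dp lq ->]]]; rewrite lie_homD //.
  rewrite (lcs_Lmc_eq0 (lie_hom_lcs hl lq)) addr0.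
  have := lie_hom_derived2 hl dp.
  elim=> [//|a s v [r [r' [dr dr' ->]]] _ ->].
  by rewrite (Lmc_metabelian dr dr') scaler0 addr0.
pose phi x := free_lift w (repr x).
have phiE z : phi (quot_pi (Lmc_ideal K m c) z) = free_lift w z.
  apply/eqP; rewrite -subr_eq0 -(lie_homB _ _ hl); apply/eqP/kill.
  exact: quot_repr.
exists phi => [|j]; last by rewrite phiE free_lift_gen.
split=> [a|] u v; rewrite -[u]quot_pi_repr -[v]quot_pi_repr.
  by rewrite -plin !phiE lin.
by rewrite -plie !phiE hlie.
Qed.

Lemma lcs_lie_derived k u v : lcs LL k.+1 u -> derived LL v -> lcs LL k.+3 (lie u v).
Proof.
move=> lu; elim=> [|a w z [p [q [_ _ ->]]] _ IH]; first by rewrite lie0r; apply: ideal0.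
rewrite lieDr lieZr; apply: idealP => //.
have -> : lie u (lie p q) = lie (lie u p) q - lie (lie u q) p.
  by rewrite lie_der addrC addKr.
by apply: idealB; apply/lcs_lie/lcs_lie.
Qed.

(** The map 1 - [phi] raises the lower central series by one step, so it is nilpotent and [phi] is
    inverted by a finite Neumann series. *)
Lemma IA_of_gens phi : lie_hom phi -> (forall j, derived LL (phi (y j) - y j)) -> IA phi.
Proof.
move=> hphi hy; have [lin hlie] := hphi.
have phiD u : derived LL (phi u - u).
  elim/Lmc_ind: u => [|a u v du dv|u v _ _|//].
  - by rewrite lie_hom0 // subr0; apply: ideal0.
  - by rewrite lin opprD addrACA -scalerBr; apply: idealP.
  - by rewrite hlie; apply: idealB; apply: derived_lie.
have phi_lcs k u : lcs LL k.+1 u -> lcs LL k.+2 (phi u - u).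
  elim: k u => [|k IH] u; first by move=> _; apply: phiD.
  rewrite {1}lcsS //; elim=> [|a w z [p [q [lp _ ->]]] _ lz].
    by rewrite lie_hom0 // subr0; apply: ideal0.
  rewrite lin opprD addrACA -scalerBr; apply: idealP => //.
  (* The first summand gains a step by induction on [p]; the second gains two, because [phi q - q]
     lies in the derived ideal. *)
  rewrite hlie (_ : _ - _ = lie (phi p - p) (phi q) + lie p (phi q - q)).
    apply: idealD; first by apply/lcs_lie/IH.
    exact: lcs_lie_derived.
  by rewrite lieDl lieDr lieNl lieNr addrA subrK.
pose M u := u - phi u; pose psi u := \sum_(0 <= k < c) iter k M u.
have M_lcs k u : lcs LL k.+1 (iter k M u).
  elim: k => // k IH; rewrite iterS /M -(opprB (phi _)).
  exact/idealN/phi_lcs.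
have telescope_M u : \sum_(0 <= k < c) (iter k M u - iter k.+1 M u) = u.
  transitivity (- \sum_(0 <= k < c) (iter k.+1 M u - iter k M u)).
    by rewrite -sumrN; apply: eq_bigr => k _; rewrite [RHS]opprB.
  by rewrite telescope_sumr //= (lcs_Lmc_eq0 (M_lcs _ _)) sub0r opprK.
have MB u v : M (u - v) = M u - M v.
  by rewrite /M lie_homB // !opprD !opprK addrACA.
split=> //; split=> //; exists psi => u.
  have -> : psi (phi u) = \sum_(0 <= k < c) (iter k M u - iter k.+1 M u).
    apply: eq_bigr => k _; rewrite iterSr.
    have -> : phi u = u - M u by rewrite opprB addrC subrK.
    by elim: k => //= k ->; rewrite MB.
  exact: telescope_M.
rewrite -[RHS]telescope_M /psi.
rewrite (big_morph phi (fun a b => lie_homD a b hphi) (lie_hom0 hphi)).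
by apply: eq_bigr => k _; rewrite /= {3}/M opprB addrC subrK.
Qed.

Lemma IA_comp phi psi : IA phi -> IA psi -> IA (phi \o psi).
Proof.
move=> [[hphi _] dphi] [[hpsi _] dpsi]; apply: IA_of_gens; first exact: lie_hom_comp.
move=> j /=; rewrite -(subrKA (psi (y j))).
exact: idealD (dphi _) (dpsi _).
Qed.

End Endomorphisms.

(** * Power series in ad u and the derivatives of inner automorphisms *)

Section InnerAutomorphisms.
Variables (K : fieldType) (m c : nat).
Local Notation LL := (Lmc K m c).
Local Notation y := (@gen K m c).
Local Notation poly := {mpoly K[m]}.
Implicit Types (u v w x : LL).

Definition ad_series (g : nat -> K) u w : LL := \sum_(k < c) g k *: iter k (ad u) w.

(** The term [v] is split off, leaving the series (exp z - 1)/z applied to an element of the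
    commutator ideal, where [ad u] acts on derivatives as multiplication by [lpart u]. *)
Lemma exp_adE u v :
  exp_ad u v = v + ad_series (fun k => (k.+1)`!%:R^-1) u (lie v u).
Proof.
rewrite /exp_ad /ad_series.
(* The extra term is zero by nilpotency; with it, removing k = 0 leaves exactly c terms. *)
transitivity (\sum_(k < c.+1) (k`!%:R : K)^-1 *: iter k (ad u) v).
  by rewrite big_ord_recr /= ad_nilp // scaler0 addr0.
rewrite big_ord_recl /= invr1 scale1r; congr (_ + _).
by apply: eq_bigr => k _; rewrite /bump /= add1n -iterS iterSr.
Qed.

Lemma ad_series_derived g u w : derived LL w -> derived LL (ad_series g u w).
Proof. by move=> dw; apply: ideal_sum => k _; apply/idealZ/iter_ad_derived. Qed.

Lemma ad_series_linear g u : linear (ad_series g u).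
Proof.
move=> a v w; rewrite /ad_series scaler_sumr -big_split; apply: eq_bigr => k _.
by rewrite iter_ad_linear scalerDr !scalerA mulrC.
Qed.

(** In the Leibniz expansion of a power of [ad u] on a bracket, every term with [u] acting on both
    factors is a bracket of two commutators and vanishes. Only the two extreme terms survive. *)
Lemma ad_series_lie g u v w :
  ad_series g u (lie (lie v w) u) =
  lie (ad_series g u (lie v u)) w + lie v (ad_series g u (lie w u)).
Proof.
rewrite /ad_series lie_suml lie_sumr -big_split; apply: eq_bigr => k _ /=.
rewrite lieZl lieZr -scalerDr; congr (_ *: _).
elim: (nat_of_ord k) => [|n IH] /=; first exact: lie_der.
have da v' w' : derived LL (iter n (ad u) (lie v' w')) by apply/iter_ad_derived/derived_lie.
rewrite IH {1}/ad lieDl (lie_der (iter n _ _) w) (lie_der v (iter n _ _)).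
by rewrite (Lmc_metabelian (da _ _) (derived_lie _ _)) (Lmc_metabelian (derived_lie _ _) (da _ _)) addr0 add0r.
Qed.

Lemma exp_ad_hom u : lie_hom (exp_ad u).
Proof.
split=> [a|] v w; rewrite !exp_adE.
  by rewrite lie_linearl ad_series_linear scalerDr addrACA.
rewrite ad_series_lie lieDl !lieDr.
rewrite [lie (ad_series _ _ _) (ad_series _ _ _)](Lmc_metabelian
  (ad_series_derived _ _ (derived_lie _ _)) (ad_series_derived _ _ (derived_lie _ _))) addr0.
by rewrite -!addrA; congr (_ + _); rewrite addrC.
Qed.

Lemma exp_ad_IA u : IA (exp_ad u).
Proof.
apply: IA_of_gens; first exact: exp_ad_hom.
by move=> j; rewrite exp_adE addrC addKr; apply/ad_series_derived/derived_lie.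
Qed.

Hypothesis c_gt0 : (0 < c)%N.

Lemma pd_ad_series g u w i : derived LL w ->
  eqmodX c (pd i (ad_series g u w)) ((\sum_(k < c) g k *: lpart u ^+ k) * pd i w).
Proof.
move=> dw; apply/eqmodX_mtrunc; rewrite -/(tpd _ _) /ad_series linear_sum mulr_suml linear_sum.
apply: eq_bigr => k _; rewrite -scalerAl !linearZ /=; congr (_ *: _).
by apply/tpdE/pd_iter_ad.
Qed.

Lemma pd_add_mod i u v : eqmodX c (pd i (u + v)) (pd i u + pd i v).
Proof. by have := pd_linear_mod i 1 u v; rewrite !scale1r. Qed.

Definition texp (t : poly) : poly := \sum_(k < c) (k`!%:R : K)^-1 *: t ^+ k.
Definition texp1 (t : poly) : poly := \sum_(k < c) ((k.+1)`!%:R : K)^-1 *: t ^+ k.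

Lemma pd_exp_ad i u v : eqmodX c (pd i (exp_ad u v)) (pd i v + texp1 (lpart u) * pd i (lie v u)).
Proof.
rewrite exp_adE; apply: eqmodX_trans (pd_add_mod _ _ _) _.
rewrite /eqmodX opprD addrACA subrr add0r.
exact: (pd_ad_series (fun k => k.+1`!%:R^-1) u i (derived_lie v u)).
Qed.

Lemma pd_exp_ad_derived i u w : derived LL w ->
  eqmodX c (pd i (exp_ad u w)) (texp (lpart u) * pd i w).
Proof. exact: (pd_ad_series (fun k => k`!%:R^-1)). Qed.

End InnerAutomorphisms.

(** * Normal forms of Jacobian matrices *)

Section PolynomialFacts.
Variables (K : fieldType) (m : nat).
Local Notation poly := {mpoly K[m]}.
Implicit Types (f g : poly) (e : 'X_{1..m}) (A U : 'I_m -> poly).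

Lemma free_ofP f i : free_of f i <-> forall e, (0 < e i)%N -> f@_e = 0.
Proof.
split=> [h e ei|h e]; last first.
  by rewrite mcoeff_msupp; case: (posnP (e i)) => // /h ->; rewrite eqxx.
by apply/eqP; rewrite mcoeff_eq0; apply/negP => /h e0; rewrite e0 in ei.
Qed.

Lemma msize_leP n f : (forall e, (n <= mdeg e)%N -> f@_e = 0) -> (msize f <= n)%N.
Proof.
move=> h; rewrite msizeE big_seq; apply: (big_ind (fun k => k <= n)%N) => // [a b|e].
  by rewrite geq_max => ->.
by rewrite mcoeff_msupp; apply: contraR; rewrite -leqNgt => /h ->.
Qed.

Lemma mcoeff_XM1 f i j : ('X_i * f)@_U_(j)%MM = (i == j)%:R * f@_0%MM.
Proof.
rewrite mcoeff_XM mnm1E eq_sym; case: eqP => [->|_] /=; last by rewrite mul0r.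
rewrite mul1r; congr (f@_ _); apply/mnmP => l; by rewrite mnmBE subnn mnm0E.
Qed.

(** The coefficient of t_i in the syzygy is the constant term of its i-th entry. *)
Lemma syzygy_omega A : \sum_i 'X_i * A i = 0 -> forall i, omega (A i).
Proof.
move=> A0 i; have := congr1 (mcoeff U_(i)%MM) A0; rewrite mcoeff0 raddf_sum /=.
rewrite (bigD1 i) //= mcoeff_XM1 eqxx mul1r big1 ?addr0 // => j /negbTE ji.
by rewrite mcoeff_XM1 ji mul0r.
Qed.

Lemma mulX_eq0 i f : 'X_i * f = 0 -> f = 0.
Proof.
move=> h; apply/mpolyP => e; have := congr1 (mcoeff (e + U_(i))%MM) h.
by rewrite mcoeff_XM mnmDE mnm1E eqxx addn1 addmK !mcoeff0.
Qed.

(** Each monomial of ['X_i * d i] has t_i as its variable of lowest index, so different summands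
    cannot cancel. *)
Lemma triangular_syzygy n (P : pred 'I_m) (d : 'I_m -> poly) :
  (forall i k : 'I_m, P i -> (k < i)%N -> free_of (d i) k) ->
  omegaX n.+1 (\sum_(i | P i) 'X_i * d i) -> forall i, P i -> omegaX n (d i).
Proof.
move=> tri /omegaXP h i Pi; apply/omegaXP => e lt_e.
have [[k [ki ek]]|/forallNP no_k] := pselect (exists k : 'I_m, (k < i)%N /\ (0 < e k)%N).
  by move: (tri i k Pi ki) => /free_ofP; apply.
have := h (e + U_(i))%MM; rewrite mdegD mdeg1 addn1 ltnS => /(_ lt_e).
rewrite raddf_sum (bigD1 i) //= mcoeff_XM mnmDE mnm1E eqxx addn1 /= addmK.
rewrite big1 ?addr0 // => k /andP[Pk ki]; rewrite mcoeff_XM mnmDE mnm1E.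
case: ifP => // ek; case: (ltngtP k i) => [lt_ki|lt_ik|/val_inj E]; last by rewrite E eqxx in ki.
  case: (no_k k); split=> //; move: ek.
  by rewrite eq_sym (negbTE ki) addn0.
move: (tri k i Pk lt_ik) => /free_ofP; apply.
by rewrite mnmBE mnmDE !mnm1E eqxx (negbTE ki) subn0 addn1.
Qed.

Lemma texp_coeff0 c (g : nat -> K) f : (0 < c)%N -> g 0%N = 1 -> omega f ->
  (\sum_(k < c) g k *: f ^+ k)@_0%MM = 1.
Proof.
case: c => // c _ g0 f0; rewrite big_ord_recl /= g0 scale1r expr0 mcoeffD mcoeff1 eqxx.
rewrite raddf_sum big1 ?addr0 // => k _.
by rewrite /= mcoeffZ exprS (rmorphM (mcoeff 0%MM)) /= f0 mul0r mulr0.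
Qed.

Lemma texp1_0 c f : (0 < c)%N -> omega f -> (texp1 c f)@_0%MM = 1.
Proof. by move=> c0 f0; apply: (texp_coeff0 (g := fun k => (k.+1)`!%:R^-1)); rewrite ?invr1. Qed.

Lemma texp_0 c f : (0 < c)%N -> omega f -> (texp c f)@_0%MM = 1.
Proof. by move=> c0 f0; apply: (texp_coeff0 (g := fun k => k`!%:R^-1)); rewrite ?invr1. Qed.

Definition linform (a : 'I_m -> K) : poly := \sum_r a r *: 'X_r.

Lemma linform_omega a : omega (linform a). Proof. exact: omega_lin. Qed.

(** Entry (i, j), minus the identity matrix, of the Jacobian of exp(ad u) composed with an
    automorphism of Jacobian I + W. Here [linform a] is the linear part of u and [U] the derivatives
    of its commutator part; see [pd_exp_ad_column]. *)
Definition coset_column c a U (W : 'I_m -> 'I_m -> poly) i j : poly :=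
  texp1 c (linform a) * ((i == j)%:R * linform a - a i *: 'X_j - 'X_j * U i)
  + texp c (linform a) * W i j.

Lemma coset_column_coeff1 c a U W i j l : (0 < c)%N ->
  omega (U i) -> omega (W i j) ->
  (coset_column c a U W i j)@_U_(l)%MM
    = (i == j)%:R * a l - a i * (j == l)%:R + (W i j)@_U_(l)%MM.
Proof.
move=> c0 oU oW; rewrite /coset_column mcoeffD.
have ol := linform_omega a; rewrite !mul_unit_linear_coeff ?texp_0 ?texp1_0 //; last first.
  rewrite /omega !mcoeffB mcoeffZ (omega_X K j) mulr0 subr0 !(rmorphM (mcoeff 0%MM)) /=.
  by rewrite ol (omega_X K j) mulr0 mul0r subr0.
rewrite !mcoeffB mcoeff_XM1 oU mulr0 subr0 mcoeffZ mcoeffXU; congr (_ - _ + _).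
by case: eqP => _; rewrite ?mul1r ?mul0r ?mcoeff0 ?mcoeff_lin.
Qed.

End PolynomialFacts.

(** * Uniqueness of the normal form within a coset *)

Section NormalForm.
Variables (K : fieldType) (m c : nat) (m_ge2 : (2 <= m)%N) (c_gt0 : (0 < c)%N).
Local Notation poly := {mpoly K[m]}.
Local Notation i1 := (ix1 m_ge2).
Local Notation i2 := (ix2 m_ge2).
Implicit Types (s : poly) (q r U : 'I_m -> poly) (f W : 'I_m -> 'I_m -> poly) (e : 'X_{1..m}).
Implicit Types (a : 'I_m -> K).

Lemma i21 : i2 != i1. Proof. by []. Qed.

Lemma rep_matrix_omega s q r f : rep_entries c m_ge2 s q r f ->
  forall i j, omega (rep_matrix m_ge2 s q r f i j).
Proof.
move=> h i j; rewrite mxE; case: eqP => [_|/eqP ji]; last exact: (rep_f h i ji).1.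
case: eqP => [_|/eqP ii]; first exact: (rep_s h).1.
rewrite /omega mcoeffD (rep_r h ii).1 addr0.
by rewrite (rmorphM (mcoeff 0%MM)) /= (omega_X K i1) mul0r.
Qed.

(** Each t_i q_i lies in omega^2, so the relation with s, read in degree one, leaves only s. *)
Lemma rep_s_linear s q r f l : rep_entries c m_ge2 s q r f -> s@_U_(l)%MM = 0.
Proof.
move=> h; have /omegaXP := rep_sum_q h; rewrite subr0 => /(_ U_(l)%MM).
rewrite mdeg1 ltnS c_gt0 => /(_ isT); rewrite mcoeffD raddf_sum /= big1 ?addr0 // => i ii.
by rewrite mcoeff_XM1 (rep_q h ii).1 mulr0.
Qed.

(** Linear terms give [a = a']. Dividing by the exponential then leaves a difference of the form t_j
    Z_i, and the shape of the first column forces every Z_i into omega^(c-1). *)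
Lemma normal_form_unique a a' U U' s s' q q' r r' f f' :
  (forall i, omega (U i)) -> (forall i, omega (U' i)) ->
  rep_entries c m_ge2 s q r f -> rep_entries c m_ge2 s' q' r' f' ->
  (forall i j, eqmodX c (coset_column c a U (rep_matrix m_ge2 s q r f) i j)
     (coset_column c a' U' (rep_matrix m_ge2 s' q' r' f') i j)) ->
  mx_eqmodX c (rep_matrix m_ge2 s q r f) (rep_matrix m_ge2 s' q' r' f').
Proof.
move=> oU oU' h h' E; set W := rep_matrix _ _ _ _ _ in E *; set W' := rep_matrix _ s' _ _ _ in E *.
have oW : forall i j, omega (W i j) by exact: rep_matrix_omega h.
have oW' : forall i j, omega (W' i j) by exact: rep_matrix_omega h'.
(* For c = 1 linear terms are invisible modulo omega^c, but then all entries are congruent to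
   zero. *)
have [c1|c_gt1] := leqP c 1.
  move=> i j; have -> : c = 1%N by apply/eqP; rewrite eqn_leq c1.
  by apply: omega_omegaX1; rewrite /omega mcoeffB oW oW' subrr.
have El i j l : (i == j)%:R * a l - a i * (j == l)%:R + (W i j)@_U_(l)%MM =
                (i == j)%:R * a' l - a' i * (j == l)%:R + (W' i j)@_U_(l)%MM.
  rewrite -(@coset_column_coeff1 _ _ c a U W i j l c_gt0 (oU i) (oW i j)).
  rewrite -(@coset_column_coeff1 _ _ c a' U' W' i j l c_gt0 (oU' i) (oW' i j)); apply/eqP; rewrite -subr_eq0 -mcoeffB.
  by apply/eqP; have /omegaXP := E i j; apply; rewrite mdeg1.
(* The coefficient of t_2 in entry (1, 2) is -a_1, because f_12 has no such term; that of t_l in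
   entry (1, 1) is a_l for the other l, because s has no linear terms. *)
have aa' : a = a'.
  apply/funext => l; have [->|li] := eqVneq l i1.
    have := El i1 i2 i2; rewrite !mxE (negbTE i21) (rep_f12 h) (rep_f12 h') eqxx.
    by rewrite (_ : i1 == i2 = false) // !mul0r !sub0r !mulr1 !addr0 => /oppr_inj.
  have := El i1 i1 l; rewrite !mxE eqxx (rep_s_linear _ h) (rep_s_linear _ h').
  by rewrite eq_sym (negbTE li) !mul1r !mulr0 !subr0 !addr0.
move: E; rewrite /coset_column -aa'; set T := texp1 _ _; set X := texp _ _ => E.
have X0 : X@_0%MM = 1 by rewrite texp_0 //; apply: linform_omega.
have [G XG] := @eqmodX_inv _ _ c _ X0.
pose Z i := G * T * (U i - U' i).
have WZ i j : eqmodX c (W i j - W' i j) ('X_j * Z i).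
  rewrite /eqmodX; have := omegaX_mull G (E i j).
  move/(omegaXB (omegaX_mull (W i j - W' i j) XG)) => /omegaXN.
  by rewrite /Z; congr omegaX; ring.
have [n cE] : exists n, c = n.+1 by exists c.-1; rewrite prednK.
clearbody Z; clear E El XG X0; rewrite cE in WZ h h' *.
(* Only the last of the three terms involves t_1, so its coefficients must vanish separately in low
   degree. *)
have split1 (fr fr' g : poly) : free_of fr i1 -> free_of fr' i1 ->
    omegaX n.+1 (fr - fr' - 'X_i1 * g) -> omegaX n g.
  move=> /free_ofP hfr /free_ofP hfr' /omegaXP hg.
  apply: (@omegaX_XM _ _ _ i1); apply/omegaXP => e lt_e.
  case: (posnP (e i1)) => [e1|e1]; first by rewrite mcoeff_XM e1.
  by have := hg e lt_e; rewrite !mcoeffB hfr // hfr' // subrr sub0r => /eqP; rewrite oppr_eq0 => /eqP.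
have Z1 : omegaX n (Z i1).
  have := WZ i1 i1; rewrite /eqmodX !mxE eqxx /=.
  exact: (split1 _ _ _ (rep_s_vars h) (rep_s_vars h')).
have ss' : s = s'.
  apply/eqP; rewrite -subr_eq0; apply/eqP; apply: (@omegaX_small _ _ n.+1).
    apply: msize_leP => e le_e; rewrite mcoeffB.
    rewrite !(memN_msupp_eq0 (msize_mdeg_ge _)) ?subr0 //; apply: leq_trans le_e.
      exact: (rep_s h').2.
    exact: (rep_s h).2.
  have := WZ i1 i1; rewrite /eqmodX !mxE eqxx /= => hs.
  rewrite -[s - s'](subrK ('X_i1 * Z i1)); apply: omegaXD => //.
  exact: (@omegaX_mul _ _ 1 n _ _ (omega_omegaX1 (omega_X _ _))).
(* With s and s' equal, the relations for q and q' differ by a triangular syzygy. *)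
have qq' i : i != i1 -> omegaX n (q i - q' i).
  move=> ii; apply: (@triangular_syzygy _ _ _ (fun i => i != i1) (fun i => q i - q' i)) ii.
    move=> l k li kl; apply/free_ofP => e ek; rewrite mcoeffB.
    have /free_ofP -> // := rep_q_vars h li kl; have /free_ofP -> // := rep_q_vars h' li kl.
    by rewrite subrr.
  apply: (@omegaXW _ _ _ n.+2) => //.
  have := omegaXB (rep_sum_q h) (rep_sum_q h'); rewrite !subr0 ss' opprD addrACA subrr add0r.
  by rewrite -sumrB; congr omegaX; apply: eq_bigr => l _; rewrite mulrBr.
have ZZ i : omegaX n (Z i).
  have [->//|ii] := eqVneq i i1.
  have := WZ i i1; rewrite /eqmodX !mxE eqxx (negbTE ii) /= => hr.
  rewrite -[Z i](subrK (q i - q' i)); apply: omegaXD; last exact: qq'.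
  apply: (split1 _ _ _ (rep_r_vars h ii) (rep_r_vars h' ii)).
  by move: hr; congr omegaX; ring.
move=> i j; rewrite /eqmodX -[_ - _](subrK ('X_j * Z i)); apply: omegaXD; first exact: WZ.
exact: (@omegaX_mul _ _ 1 n _ _ (omega_omegaX1 (omega_X _ _))).
Qed.

End NormalForm.

(** * Existence of the normal form within a coset *)

Section Existence.
Variables (K : fieldType) (m c : nat) (m_ge2 : (2 <= m)%N) (c_gt0 : (0 < c)%N).
Local Notation poly := {mpoly K[m]}.
Local Notation i1 := (ix1 m_ge2).
Local Notation i2 := (ix2 m_ge2).
Implicit Types (e : 'X_{1..m}).

Definition without1 (f : poly) : poly := mdiag (fun e => (e i1 == 0%N)%:R) f.
(** The monomials in which no variable before t_i occurs; dividing by t_i then keeps exactly those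
    whose lowest variable is t_i. *)
Definition leading_var (s : poly) (i : 'I_m) : poly :=
  mdiag (fun e => [forall k : 'I_m, (k < i)%N ==> (e k == 0%N)]%:R) s.

Lemma without1_free f : free_of (without1 f) i1.
Proof. by apply/free_ofP => e; rewrite mcoeff_mdiag lt0n => /negbTE ->; rewrite mul0r. Qed.

Lemma without1_split f : f = without1 f + 'X_i1 * mdivX i1 f.
Proof.
rewrite mulX_mdivX; apply/mpolyP => e; rewrite mcoeffD !mcoeff_mdiag lt0n.
by case: eqP; rewrite ?mul1r ?mul0r ?addr0 ?add0r.
Qed.

Lemma min_var e : e != 0%MM ->
  exists2 i : 'I_m, (0 < e i)%N & forall k : 'I_m, (k < i)%N -> e k = 0%N.
Proof.
move=> e0; have [i ei] : exists i, (0 < e i)%N.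
  apply/not_existsP => h; case/eqP: e0; apply/mnmP => k; rewrite mnm0E.
  by apply/eqP; rewrite eqn0Ngt; apply/negP/h.
case: (arg_minnP (fun k : 'I_m => nat_of_ord k) (i0 := i) (P := fun k => 0 < e k)%N ei) => j ej min_j.
exists j => // k lt_kj; apply/eqP; rewrite eqn0Ngt; apply/negP => /min_j.
by rewrite leqNgt lt_kj.
Qed.

(** Every nonconstant monomial has exactly one lowest variable and is therefore counted once. *)
Lemma sum_leading_var s : free_of s i1 -> omega s ->
  \sum_(i | i != i1) 'X_i * mdivX i (leading_var s i) = s.
Proof.
move=> /free_ofP s1 s0; apply/mpolyP => e; rewrite raddf_sum /=.
under eq_bigr do rewrite mulX_mdivX mcoeff_mdiag mcoeff_mdiag mulrA.
rewrite -mulr_suml; have [->|se] := eqVneq s@_e 0; first by rewrite mulr0.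
have e1 : e i1 = 0%N by apply/eqP; rewrite eqn0Ngt; apply: contra se => /s1 ->.
have /min_var[i ei min_i] : e != 0%MM by apply: contra se => /eqP ->; rewrite s0.
have ii : i != i1 by apply: contraTneq ei => ->; rewrite e1.
rewrite (bigD1 i) //= ei mul1r (_ : [forall k, _] = true); last first.
  by apply/forallP => k; apply/implyP => /min_i ->.
rewrite big1 ?addr0 ?mul1r // => k /andP[k1 ki].
case: (ltngtP k i) => [lt_ki|lt_ik|/val_inj E]; last by rewrite E eqxx in ki.
  by rewrite min_i // mul0r.
rewrite (_ : [forall l, _] = false) ?mulr0 //; apply/negbTE/forallPn; exists i.
by rewrite lt_ik /= -lt0n.
Qed.

(* [Q] is forced: [t_1 Q] cancels the multiples of [t_1] in [A] other than the [t_1 q_i]. *)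
Lemma syzygy_normal_form (A : 'I_m -> poly) : \sum_i 'X_i * A i = 0 ->
  exists Q q : 'I_m -> poly, [/\ \sum_i 'X_i * Q i = 0,
    A i1 = without1 (A i1) + 'X_i1 * Q i1,
    forall i, i != i1 -> A i = 'X_i1 * q i + without1 (A i) + 'X_i1 * Q i,
    \sum_(i | i != i1) 'X_i * without1 (A i) = 0
    & forall i, q i = - mdivX i (leading_var (without1 (A i1)) i)].
Proof.
move=> A0; have oA := syzygy_omega A0.
set s := without1 (A i1); pose B i := mdivX i1 (A i).
pose q i := - mdivX i (leading_var s i).
have sq : \sum_(i | i != i1) 'X_i * q i = - s.
  rewrite -[in RHS](@sum_leading_var s) -?sumrN; last first.
  - by rewrite /omega mcoeff_mdiag oA mulr0.
  - exact: without1_free.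
  by apply: eq_bigr => i _; rewrite mulrN.
(* The syzygy splits as t_1 Y + R with R free of t_1, so Y and R vanish separately. *)
pose Y := s + 'X_i1 * B i1 + \sum_(i | i != i1) 'X_i * B i.
pose R := \sum_(i | i != i1) 'X_i * without1 (A i).
have YR : 'X_i1 * Y + R = 0.
  rewrite -A0 (bigD1 i1) //= [in RHS](without1_split (A i1)) -/s -/(B i1) /Y /R.
  rewrite mulrDr -addrA; congr (_ + _); rewrite mulr_sumr -big_split /=.
  apply: eq_bigr => i _; rewrite [in RHS](without1_split (A i)) -/(B i) mulrDr addrC.
  by rewrite mulrCA.
have R0 : R = 0.
  apply/mpolyP => e; rewrite mcoeff0; case: (posnP (e i1)) => e1.
    by have := congr1 (mcoeff e) YR; rewrite mcoeffD mcoeff_XM e1 add0r mcoeff0.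
  rewrite raddf_sum big1 //= => i ii; rewrite mcoeff_XM; case: ifP => // ei.
  have /free_ofP -> // := @without1_free (A i).
  by rewrite mnmBE mnm1E (negbTE ii) subn0.
have Y0 : Y = 0 by move: YR; rewrite R0 addr0 => /mulX_eq0.
(* The contraction of this vector with the variables is Y, since the q_i contract to -s. *)
exists (fun i => if i == i1 then B i1 else B i - q i), q; split=> //.
- rewrite (bigD1 i1) //=.
  have -> : \sum_(i | i != i1) 'X_i * (if i == i1 then B i1 else B i - q i)
      = \sum_(i | i != i1) 'X_i * B i - \sum_(i | i != i1) 'X_i * q i.
    by rewrite -sumrB; apply: eq_bigr => i /negbTE ->; rewrite mulrBr.
  by rewrite sq opprK -[RHS]Y0 /Y addrA addrC addrA.
- by rewrite -without1_split.
- move=> i /negbTE ->; rewrite {1}(without1_split (A i)) -/(B i).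
  ring.
Qed.

(** The formula for [coset_column] is solved for [W] in terms of [a] and [U]; [a] is then fixed by
    linear terms and [U] by the multiples of t_1 in the first column. *)
Lemma coset_column_normal_form (V : 'I_m -> 'I_m -> poly) :
  (forall j, \sum_i 'X_i * V i j = 0) ->
  exists (a : 'I_m -> K) (U : 'I_m -> poly) (W : 'I_m -> 'I_m -> poly),
  [/\ \sum_i 'X_i * U i = 0, forall j, \sum_i 'X_i * W i j = 0,
     forall i j, eqmodX c (V i j) (coset_column c a U W i j)
   & exists s q r f, rep_entries c m_ge2 s q r f /\
       mx_eqmodX c (\matrix_(i, j) W i j) (rep_matrix m_ge2 s q r f)].
Proof.
move=> V0; have oV j := syzygy_omega (V0 j).
(* These values remove the coefficient of t_2 from entry (1, 2) and the linear coefficients of t_2,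
   ..., t_m from entry (1, 1). *)
pose a l := if l == i1 then - (V i1 i2)@_U_(i2)%MM else (V i1 i1)@_U_(l)%MM.
pose t := linform a; have ot : omega t by exact: linform_omega.
pose T := texp1 c t; pose E := texp c t.
have T0 : T@_0%MM = 1 by exact: texp1_0.
have E0 : E@_0%MM = 1 by exact: texp_0.
have [G EG] := @eqmodX_inv _ _ c _ E0; have [S TS] := @eqmodX_inv _ _ c _ T0.
have G0 : G@_0%MM = 1.
  have /omegaXP/(_ 0%MM) := EG; rewrite mdeg0 => /(_ c_gt0).
  rewrite mcoeffB (rmorphM (mcoeff 0%MM)) /= E0 mul1r mcoeff1 eqxx.
  by move/eqP; rewrite subr_eq0 => /eqP.
pose V0' i j := V i j - T * ((i == j)%:R * t - a i *: 'X_j).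
pose V' i j := G * V0' i j.
have oV0' i j : omega (V0' i j).
  rewrite /omega mcoeffB oV sub0r (rmorphM (mcoeff 0%MM)) /= T0 mul1r mcoeffB.
  by rewrite (rmorphM (mcoeff 0%MM)) /= ot mulr0 mcoeffZ (omega_X K j) mulr0 subrr oppr0.
have V'1 i j l : (V' i j)@_U_(l)%MM = (V i j)@_U_(l)%MM - ((i == j)%:R * a l - a i * (j == l)%:R).
  rewrite mul_unit_linear_coeff // mcoeffB mul_unit_linear_coeff //; last first.
    rewrite /omega mcoeffB (rmorphM (mcoeff 0%MM)) /= ot mulr0 mcoeffZ (omega_X K j).
    by rewrite mulr0 subrr.
  rewrite mcoeffB mcoeffZ mcoeffXU; congr (_ - (_ - _)).
  by case: eqP => _; rewrite ?mul1r ?mul0r ?mcoeff0 ?mcoeff_lin.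
have V'0 j : \sum_i 'X_i * V' i j = 0.
  have -> : \sum_i 'X_i * V' i j = G * (\sum_i 'X_i * V i j -
      T * (\sum_i (i == j)%:R * ('X_i * t) - 'X_j * \sum_i a i *: 'X_i)).
    rewrite mulr_sumr -sumrB mulr_sumr -sumrB mulr_sumr; apply: eq_bigr => i _.
    by rewrite /V' /V0' -!mul_mpolyC; ring.
  rewrite V0 -/(linform a) -/t (bigD1 j) //= eqxx mul1r big1 => [|i /negbTE ->]; last by rewrite mul0r.
  by rewrite addr0 subrr mulr0 subrr mulr0.
(* Truncation keeps the syzygy exact and bounds the degrees of s and r. *)
pose A i := mtrunc c (V' i i1).
have A0 : \sum_i 'X_i * A i = 0 by rewrite mtrunc_sumX V'0 linear0.
have oA := syzygy_omega A0.
have [Q [q [Q0 A1 Ai r0 qE]]] := syzygy_normal_form A0.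
(* As [G * E] and [T * S] are congruent to 1, the correction [G * T * 'X_i1 * U i] to the first
   column is congruent to -t_1 Q_i. *)
pose U i := - (S * E * Q i).
pose W i j := V' i j + G * T * 'X_j * U i.
have U0 : \sum_i 'X_i * U i = 0.
  under eq_bigr do rewrite /U mulrN mulrCA.
  by rewrite sumrN -mulr_sumr Q0 mulr0 oppr0.
have W0 j : \sum_i 'X_i * W i j = 0.
  have E' i : 'X_i * W i j = 'X_i * V' i j + G * T * 'X_j * ('X_i * U i) by rewrite /W; ring.
  under eq_bigr do rewrite E'.
  by rewrite big_split /= V'0 -mulr_sumr U0 mulr0 addr0.
have oU := syzygy_omega U0; have oW j := syzygy_omega (W0 j).
exists a, U, W; split=> //.
  move=> i j; rewrite /eqmodX /coset_column -/t -/T -/E.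
  rewrite (_ : _ - _ = - (E * G - 1) * (V0' i j + T * 'X_j * U i)); first exact: omegaXM (omegaXN EG).
  by rewrite /W /V' /V0'; ring.
pose s := without1 (A i1); pose r i := without1 (A i).
pose f i j := mtrunc c (W i j).
have W1 i : eqmodX c (W i i1) (A i - 'X_i1 * Q i).
  rewrite /eqmodX (_ : _ - _ = - (mtrunc c (V' i i1) - V' i i1)
     - ((E * G - 1) * (T * S) + (T * S - 1)) * ('X_i1 * Q i)).
    apply: omegaXB; first exact/omegaXN/mtrunc_eqmodX.
    by apply/omegaXM/omegaXD => //; apply: omegaXM.
  by rewrite /W /U /A; ring.
exists s, q, r, f; split; last first.
  move=> i j; rewrite !mxE; case: eqP => [->|_]; last first.
    by have := omegaXN (mtrunc_eqmodX c (W i j)); rewrite opprB.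
  have := W1 i; case: eqP => [->|/eqP ii].
    by rewrite {1}A1 addrK.
  by rewrite {1}(Ai i ii) addrK.
have s_high e : (c <= mdeg e)%N -> s@_e = 0.
  by move=> le_e; rewrite mcoeff_mdiag mcoeff_mtrunc ltnNge le_e mulr0.
have q_coef i e : (q i)@_e = - ([forall k : 'I_m, (k < i)%N ==> ((e + U_(i))%MM k == 0%N)]%:R * s@_(e + U_(i))%MM).
  by rewrite qE mcoeffN mcoeff_mdivX mcoeff_mdiag.
split.
- by split; [rewrite /omega mcoeff_mdiag oA mulr0 | apply: msize_leP].
- move=> i ii; split.
    (* The constant term of q_i is minus the coefficient of t_i in s, which the choice of [a i]
       makes zero. *)
    rewrite /omega q_coef add0m [s@_ _]mcoeff_mdiag mcoeff_mtrunc mdeg1 V'1 !eqxx.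
    rewrite [i1 == i]eq_sym (negbTE ii) mulr0 subr0 mul1r /a (negbTE ii) subrr.
    by case: ifP; rewrite !mulr0 oppr0.
  apply: msize_leP => e le_e; rewrite q_coef s_high ?mulr0 ?oppr0 //.
  by rewrite mdegD (leq_trans le_e) // leq_addr.
- move=> i ii; split; first by rewrite /omega mcoeff_mdiag oA mulr0.
  by apply: msize_leP => e le_e; rewrite mcoeff_mdiag mcoeff_mtrunc ltnNge le_e mulr0.
- move=> i j ji; split; last exact: msize_mtrunc.
  by rewrite /omega mcoeff_mtrunc oW; case: ifP.
- apply: eq_eqmodX; under eq_bigr do rewrite qE mulrN.
  rewrite sumrN sum_leading_var ?subrr //; first exact: without1_free.
  by rewrite /omega mcoeff_mdiag oA mulr0.
- exact: eq_eqmodX.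
- by move=> j _; apply: eq_eqmodX; rewrite mtrunc_sumX W0 linear0.
- exact: without1_free.
- by move=> i _; apply: without1_free.
- move=> i k ii ki; apply/free_ofP => e ek; rewrite q_coef.
  rewrite (_ : [forall l, _] = false) ?mul0r ?oppr0 //; apply/negbTE/forallPn; exists k.
  by rewrite ki /= mnmDE addn_eq0 negb_and -lt0n ek.
- rewrite /f mcoeff_mtrunc mdeg1; case: ifP => // _.
  rewrite /W mcoeffD V'1 -mulrA mul_unit_linear_coeff.
  - rewrite mcoeff_XM1 oU mulr0 addr0 (_ : i1 == i2 = false) // mul0r sub0r opprK.
    by rewrite eqxx mulr1 /a eqxx subrr.
  - by rewrite (rmorphM (mcoeff 0%MM)) /= G0 T0 mulr1.
  - by rewrite /omega (rmorphM (mcoeff 0%MM)) /= oU mulr0.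
Qed.

End Existence.

(** * Jacobians of coset elements *)

Section Jacobians.
Variables (K : fieldType) (m c : nat) (c_gt0 : (0 < c)%N).
Local Notation LL := (Lmc K m c).
Local Notation y := (@gen K m c).
Local Notation poly := {mpoly K[m]}.
Implicit Types (u v w x : LL).

Lemma ad_poly_derived h w : derived LL w -> derived LL (ad_poly h w).
Proof. by move=> dw; apply: ideal_sum => e _; apply/idealZ/ad_monom_derived. Qed.

Lemma lpart_add u v : lpart (u + v) = lpart u + lpart v.
Proof. by have := lpart_linear c_gt0 1 u v; rewrite !scale1r. Qed.

Lemma lpart_gens_derived (a : 'I_m -> K) u0 : derived LL u0 ->
  lpart (\sum_r a r *: y r + u0) = linform a.
Proof. by move=> du; rewrite lpart_add (lpart_derived c_gt0 du) addr0 lpart_gens. Qed.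

Lemma pd_gens (a : 'I_m -> K) i : eqmodX c (pd i (\sum_r a r *: y r)) (a i)%:MP.
Proof.
have tg r : tpd i (y r) = mtrunc c (i == r)%:R by apply/tpdE/pd_gen.
apply/tpdE; rewrite linear_sum (bigD1 i) //= linearZ /= tg eqxx.
rewrite big1 ?addr0 => [|r /negbTE ri]; first by rewrite -linearZ /= -mul_mpolyC mulr1.
by rewrite linearZ /= tg eq_sym ri linear0 scaler0.
Qed.

Lemma pd_sub_mod i u v : eqmodX c (pd i (u - v)) (pd i u - pd i v).
Proof.
have := pd_linear_mod i (-1) v u; rewrite !scaleN1r.
by rewrite addrC [- _ + pd i u]addrC.
Qed.

Lemma pd_syzygy x : derived LL x -> \sum_i 'X_i * pd i x = 0.
Proof. by move=> dx; rewrite fox_identity (lpart_derived c_gt0 dx). Qed.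

Lemma Lmc_split u : exists a u0, derived LL u0 /\ u = \sum_r a r *: y r + u0.
Proof.
have [a /span_basic_derived da] := Lmc_decomposition u.
by exists a, (u - \sum_r a r *: y r); split=> //; rewrite addrC subrK.
Qed.

(** On [w j], in the commutator ideal, exp(ad u) acts on derivatives as the truncated exponential;
    on [y j] it adds the series [texp1] times the derivative of [y_j, u]. *)
Lemma pd_exp_ad_column (a : 'I_m -> K) u0 (w : 'I_m -> LL) (U : 'I_m -> poly) W i j :
  derived LL u0 -> (forall i, eqmodX c (pd i u0) (U i)) ->
  derived LL (w j) -> (forall i, eqmodX c (pd i (w j)) (W i j)) ->
  eqmodX c (pd i (exp_ad (\sum_r a r *: y r + u0) (y j + w j)))
    ((i == j)%:R + coset_column c a U W i j).
Proof.
move=> du uU dw wW; set u := _ + u0; have lu : lpart u = linform a by exact: lpart_gens_derived.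
rewrite (lie_homD _ _ (exp_ad_hom u)); apply: eqmodX_trans (pd_add_mod _ _ _) _.
rewrite addrA; apply: eqmodX_add; last first.
  apply: eqmodX_trans (pd_exp_ad_derived c_gt0 _ _ dw) _; rewrite lu.
  exact: eqmodX_mull.
apply: eqmodX_trans (pd_exp_ad c_gt0 _ _ _) _; rewrite lu.
apply: eqmodX_add; first exact: pd_gen.
apply: eqmodX_mull; apply: eqmodX_trans (pd_lie _ _ _) _; rewrite lu lpart_gen //.
rewrite -addrA -opprD; apply: eqmodX_sub; first exact/eqmodX_mulr/pd_gen.
rewrite -mul_mpolyC ['X_j * _]mulrC -mulrDl; apply: eqmodX_mulr.
by apply: eqmodX_trans (pd_add_mod _ _ _) _; apply: eqmodX_add => //; apply: pd_gens.
Qed.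

End Jacobians.

(** * The Jacobian of an inner automorphism and the coset representatives *)

Theorem corollary8 (K : fieldType) (charK0 : [pchar K] =i pred0)
    (m c : nat) (m_ge2 : (2 <= m)%N) (c_ge1 : (1 <= c)%N) :
  (forall (a : 'I_m -> K) (h : 'I_m -> 'I_m -> {mpoly K[m]}),
     (forall p q k : 'I_m, (q < p)%N -> (k < q)%N -> free_of (h p q) k) ->
     let y := @gen K m c in
     let ubar := \sum_r a r *: y r in
     let u0 := \sum_(p : 'I_m) \sum_(q : 'I_m | (q < p)%N)
                 ad_poly (h p q) (lie (y p) (y q)) in
     let u := ubar + u0 in
     let t := \sum_r a r *: ('X_r : {mpoly K[m]}) in
     let T := \sum_(k < c) ((k.+1)`!%:R : K)^-1 *: t ^+ k in
     let Dbar := \matrix_(i, j) pd i (lie (y j) ubar) in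
     let D0 := \matrix_(i, j) pd i (lie (y j) u0) in
     mx_eqmodX c (Jac (exp_ad u)) (Jac (exp_ad ubar) + T *: D0) /\
     mx_eqmodX c (Jac (exp_ad u)) (1%:M + T *: (Dbar + D0)))
  /\
  Inn_coset_representatives (Theta (K := K) (c := c) m_ge2).
Proof.
split.
  move=> a h _ y ubar u0 u t T Dbar D0.
  have du0 : derived (Lmc K m c) u0.
    apply: ideal_sum => p _; apply: ideal_sum => q _.
    exact/ad_poly_derived/derived_lie.
  have lu : lpart u = t by exact: lpart_gens_derived.
  have lubar : lpart ubar = t by exact: lpart_gens.
  have brD i j : eqmodX c (pd i (lie (y j) u)) (pd i (lie (y j) ubar) + pd i (lie (y j) u0)).
    by rewrite lieDr; apply: pd_add_mod.
  have Ju i j : eqmodX c (pd i (exp_ad u (y j)))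
      (pd i (y j) + T * (pd i (lie (y j) ubar) + pd i (lie (y j) u0))).
    apply: eqmodX_trans (pd_exp_ad c_ge1 _ _ _) _; rewrite lu -/T.
    by apply: eqmodX_add; [apply: eq_eqmodX | apply: eqmodX_mull].
  split=> i j; rewrite !mxE; apply: eqmodX_trans (Ju i j) _; last first.
    by apply: eqmodX_add; [exact: pd_gen | apply: eq_eqmodX].
  (* The first two terms are the Jacobian entry of exp(ad ubar): [ubar] and [u] have the same linear
     part, hence the same factor [T]. *)
  rewrite mulrDr addrA; apply: eqmodX_add; last exact: eq_eqmodX.
  by apply: eqmodX_sym; have := pd_exp_ad c_ge1 i ubar (y j); rewrite lubar.
have ThetaE theta : Theta (K := K) (c := c) m_ge2 theta ->
    lie_hom theta /\ exists s q r f, rep_entries c m_ge2 s q r f /\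
      forall i j, eqmodX c (pd i (theta (gen K c j) - gen K c j)) (rep_matrix m_ge2 s q r f i j).
  move=> [[hth _] [s [q [r [f [hrep hJ]]]]]]; split=> //.
  exists s, q, r, f; split=> // i j; apply: eqmodX_trans (pd_sub_mod _ _ _) _.
  rewrite -[rep_matrix _ _ _ _ _ _ _](addKr (i == j)%:R) [X in eqmodX _ _ X]addrC.
  apply: eqmodX_sub; last exact: pd_gen.
  by have := hJ i j; rewrite !mxE.
have ThetaIA theta : Theta (K := K) (c := c) m_ge2 theta -> IA theta.
  move=> /ThetaE[hth [s [q [r [f [hrep hJ]]]]]]; apply: IA_of_gens => // j.
  apply: (pd_omega_derived c_ge1) => i.
  rewrite -[pd _ _](subrK (rep_matrix m_ge2 s q r f i j)); apply: omegaXD.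
    exact: omegaXW (hJ i j).
  exact/omega_omegaX1/(rep_matrix_omega hrep).
split=> //.
  move=> phi; split=> [[[hphi _] dphi]|[theta /ThetaIA IAth [psi [u ->] ->]]]; last first.
    by apply: IA_comp => //; apply: exp_ad_IA.
  have V0 j : \sum_i 'X_i * pd i (phi (gen K c j) - gen K c j) = 0 by apply: pd_syzygy.
  have [a [U [W [U0 W0 EV [s [q [r [f [hrep hW]]]]]]]]] :=
    @coset_column_normal_form K m c m_ge2 c_ge1 (fun i j => pd i (phi (gen K c j) - gen K c j)) V0.
  (* By [pd_euler_lift] these elements realise the syzygies [U] and the columns of [W] as
     derivatives; they define the inner factor and the representative. *)
  pose u0 := euler_lift c U; pose w j := euler_lift c (W^~ j).
  have dw j : derived (Lmc K m c) (w j) by exact: euler_lift_derived.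
  have [theta hth thE] := lie_hom_of_gens (fun j => gen K c j + w j).
  have wW i j : eqmodX c (pd i (w j)) (W i j) by apply: (@pd_euler_lift _ charK0 _ _ c_ge1 (W^~ j)).
  exists theta.
    split.
      by have [] : IA theta by apply: IA_of_gens => // j; rewrite thE addrC addKr.
    exists s, q, r, f; split=> // i j; rewrite mxE thE [in X in eqmodX _ _ X]mxE.
    apply: eqmodX_trans (pd_add_mod _ _ _) _; rewrite [1%:M _ _]mxE.
    apply: eqmodX_add; first exact: pd_gen.
    by apply: eqmodX_trans (wW i j) _; have := hW i j; rewrite mxE.
  pose u := \sum_r a r *: gen K c r + u0.
  exists (exp_ad u); first by exists u.
  apply: lie_hom_gen_ext => // [|j]; first by apply: lie_hom_comp => //; apply: exp_ad_hom.
  apply: (pd_inj charK0 c_ge1) => i /=; rewrite thE.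
  apply: eqmodX_trans (eqmodX_sym (@pd_exp_ad_column _ _ _ c_ge1 a u0 w U W i j _ _ _ _)) => //.
  - rewrite -[pd i (phi _)](subrK (i == j)%:R) [X in eqmodX _ X _]addrC; apply: eqmodX_add.
      exact: eq_eqmodX.
    apply: eqmodX_trans _ (EV i j); apply: eqmodX_sym.
    apply: eqmodX_trans (pd_sub_mod _ _ _) _; apply: eqmodX_sub; first exact: eq_eqmodX.
    exact: pd_gen.
  - exact: euler_lift_derived.
  - by move=> k; apply: pd_euler_lift.
(* Both compositions equal [phi], so their Jacobians agree; uniqueness of the normal form then gives
   th and th' congruent Jacobians, hence equal values on generators. *)
move=> th th' phi Tth Tth' [_ [u ->] ->] [_ [u' ->] E].
have [hth [s [q [r [f [hrep hJ]]]]]] := ThetaE _ Tth.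
have [hth' [s' [q' [r' [f' [hrep' hJ']]]]]] := ThetaE _ Tth'.
have [_ dth] := ThetaIA _ Tth; have [_ dth'] := ThetaIA _ Tth'.
have [a [u0 [du0 uE]]] := Lmc_split u; have [a' [u0' [du0' uE']]] := Lmc_split u'.
have oU x : derived (Lmc K m c) x -> forall i, omega (pd i x).
  by move=> dx; apply/syzygy_omega/pd_syzygy.
have col i j : eqmodX c (coset_column c a (fun i => pd i u0) (rep_matrix m_ge2 s q r f) i j)
    (coset_column c a' (fun i => pd i u0') (rep_matrix m_ge2 s' q' r' f') i j).
  have H := @pd_exp_ad_column _ _ _ c_ge1 a u0 (fun j => th (gen K c j) - gen K c j)
    (fun i => pd i u0) (rep_matrix m_ge2 s q r f) i j du0 (fun i => eq_eqmodX _ (erefl _)) (dth _)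
    (fun i => hJ i j).
  have H' := @pd_exp_ad_column _ _ _ c_ge1 a' u0' (fun j => th' (gen K c j) - gen K c j)
    (fun i => pd i u0') (rep_matrix m_ge2 s' q' r' f') i j du0' (fun i => eq_eqmodX _ (erefl _)) (dth' _)
    (fun i => hJ' i j).
  move: H H'; rewrite -uE -uE' !(addrC (gen K c j)) !subrK.
  have -> : exp_ad u' (th' (gen K c j)) = exp_ad u (th (gen K c j)).
    by have /(congr1 (fun g => g (gen K c j))) := E.
  move=> /eqmodX_sym H H'; have := eqmodX_trans H H'.
  by rewrite /eqmodX opprD addrACA subrr add0r.
have R := normal_form_unique c_ge1 (oU _ du0) (oU _ du0') hrep hrep' col.
apply: lie_hom_gen_ext => // j; apply/(addIr (- gen K c j)).
apply: (pd_inj charK0 c_ge1) => i.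
apply: eqmodX_trans (hJ i j) _; apply: eqmodX_trans (R i j) _.
exact/eqmodX_sym/hJ'.
Qed.
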